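(* For $r>0$ let $f_{r,0}:\mathbb{S}^2\to\mathbb{R}^4=\mathbb{C}^2$ be the Whitney sphere, i.e. the immersion $f_{r,0}(x_1,x_2,x_3)=\frac{r}{1+x_3^2}(x_1,x_2,x_1x_3,x_2x_3)$, where $\mathbb{S}^2\subset\mathbb{R}^3$ is the unit sphere, and let $\overline{\mathbb{B}}^4$ be the closed unit ball in $\mathbb{R}^4$. For any $r>1$, $f_{r,0}(\mathbb{S}^2)\cap\overline{\mathbb{B}}^4$ is a Lagrangian surface with a Legendrian capillary boundary, which has a conformal Maslov form. Moreover, it consists of two components, each of which is a topological disk.
   Context: Coordinates on $\mathbb{R}^4=\mathbb{C}^2$ are $(x_1,x_2,y_1,y_2)$, with the standard Euclidean metric $\langle\cdot,\cdot\rangle$, the complex structure $J(x_1,x_2,y_1,y_2)=(-y_1,-y_2,x_1,x_2)$ and the symplectic form $\omega_0=\sum_{i=1}^2dx_i\wedge dy_i$. An immersed surface $\iota:\Sigma\to\mathbb{C}^2$ is Lagrangian if $\iota^*\omega_0=0$. Let $N$ be the outward unit normal of $\mathbb{S}^3=\partial\overline{\mathbb{B}}^4$ (so $N$ at $x\in\mathbb{S}^3$ is $x$). For a Lagrangian surface $\Sigma$ in the unit ball with $\partial\Sigma$ on $\mathbb{S}^3$, the boundary is Legendrian if $JN\perp T\partial\Sigma$ everywhere on $\partial\Sigma$. In that case the outward unit conormal $\mu$ of $\partial\Sigma$ in $\Sigma$ lies in $\mathrm{span}\{N,JN\}$, and the contact angle is the angle function $\theta\in[0,\pi)$ on $\partial\Sigma$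 with $\mu=\sin\theta\,N+\cos\theta\,JN$. A Lagrangian surface in the unit ball with Legendrian boundary on $\mathbb{S}^3$ is said to have Legendrian capillary boundary if its contact angle is a constant. A Lagrangian surface has conformal Maslov form if $\mathrm{div}(JH)\,g-2\nabla(JH)=0$ everywhere, where $g$ is the induced metric, $\nabla$ its Levi-Civita connection, $H=\sum_{i=1}^{2}h(e_i,e_i)$ is the mean curvature vector ($h$ the second fundamental form, $\{e_i\}$ a local orthonormal tangent frame), $JH$ is viewed as a tangent vector field, and $\nabla(JH)$ is the $(0,2)$-tensor $(X,Y)\mapsto\langle\nabla_X(JH),Y\rangle$.
   Formalization: The contact angle is constant on each of the two components separately (the values are θ and π−θ with cos θ = 1/r², so no single constant works); components are those of the immersed surface, since the two image disks meet at the origin. *)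

(* Defs.v *)
From HB Require Import structures.
From mathcomp Require Import all_boot all_order all_algebra.
From mathcomp Require Import all_classical all_reals all_analysis.

Set Implicit Arguments.
Unset Strict Implicit.
Unset Printing Implicit Defensive.

Import Order.TTheory GRing.Theory Num.Theory.
Import numFieldNormedType.Exports.

Local Open Scope classical_set_scope.
Local Open Scope ring_scope.

(* Surfaces are given by a map f, used only on the unit sphere of R^3,
   together with a region S of that sphere: the immersed surface is the
   restriction of f to S.  Points, tangent vectors and vector fields on the
   abstract surface live in 'rV_3; the ambient C^2 = R^4 is 'rV_4, with
   coordinates (x_1, x_2, y_1, y_2) at the indices 0, 1, 2, 3. *)

Section Euclidean.
Context {R : realType}.

(* The library norm on row vectors is the sup norm, hence this inner product. *)
Definition dot {n} (u v : 'rV[R]_n) : R := \sum_i u 0 i * v 0 i.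

Definition Jc (u : 'rV[R]_4) : 'rV[R]_4 :=
  \row_i [:: - u 0 2; - u 0 3; u 0 0; u 0 1]`_i.

Definition omega0 (u v : 'rV[R]_4) : R :=
  (u 0 0 * v 0 2 - u 0 2 * v 0 0) + (u 0 1 * v 0 3 - u 0 3 * v 0 1).

Definition usphere n : set 'rV[R]_n := [set x | dot x x = 1].
Definition cball n : set 'rV[R]_n := [set x | dot x x <= 1].

Fixpoint Cn (n : nat) {V W : normedModType R} (U : set V) (f : V -> W) : Prop :=
  (forall x, U x -> {for x, continuous f}) /\
  if n is m.+1 then
    (forall x v, U x -> derivable f x v) /\
    (forall v, Cn m U (fun x => 'D_v f x))
  else True.

Definition Cinfty {V W : normedModType R} (U : set V) (f : V -> W) : Prop :=
  forall n, Cn n U f.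

Definition homeomorphic {T U : topologicalType} (A : set T) (B : set U) : Prop :=
  exists (phi : T -> U) (psi : U -> T),
    [/\ {within A, continuous phi}, {within B, continuous psi},
        (forall x, A x -> B (phi x) /\ psi (phi x) = x)
      & (forall y, B y -> A (psi y) /\ phi (psi y) = y)].

Definition topological_disk {T : topologicalType} (A : set T) : Prop :=
  homeomorphic A (@cball 2).

Definition component {T : topologicalType} (A C : set T) : Prop :=
  exists2 x, A x & C = connected_component A x.

End Euclidean.

Section SphereCalculus.
Context {R : realType}.
Local Notation E3 := 'rV[R]_3.
Local Notation S2 := (@usphere R 3).

Definition sphere_tangent (p v : E3) : Prop := dot p v = 0.

Definition sphere_proj (x : E3) : E3 := (Num.sqrt (dot x x))^-1 *: x.

Definition sphere_tan_proj (q v : E3) : E3 := v - dot v q *: q.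

(* A map g on the sphere is extended off it by g \o sphere_proj; for p in S2
   and v tangent at p, sphere_diff g p v is the differential dg_p(v), and it
   depends only on the values of g on S2. *)
Definition sphere_diff {W : normedModType R} (g : E3 -> W) (p v : E3) : W :=
  'D_v (g \o sphere_proj) p.

Definition sphere_smooth {W : normedModType R} (g : E3 -> W) : Prop :=
  Cinfty [set x | x != 0] (g \o sphere_proj).

(* Boundary relative to S2; for a closed domain with smooth boundary this is
   the boundary in the sense of manifolds. *)
Definition bdry (S : set E3) : set E3 := S `&` closure (S2 `\` S).

Definition smooth_domain (S : set E3) : Prop :=
  [/\ closed S, S `<=` S2
    & forall p, bdry S p -> exists (U : set E3) (rho : E3 -> R),
        [/\ open U, U p, Cinfty U (rho : E3 -> R^o),
            S `&` U = S2 `&` U `&` [set x | rho x <= 0]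
          & exists2 v, sphere_tangent p v & 'D_v (rho : E3 -> R^o) p != 0]].

Definition bdry_tangent (S : set E3) (p v : E3) : Prop :=
  exists c : R -> E3,
    [/\ c 0 = p, (\forall t \near (0 : R), bdry S (c t))
      & is_derive (0 : R) 1 c v].

(* w is the velocity of a curve reaching p from inside S, and is not tangent
   to the boundary. *)
Definition outward (S : set E3) (p w : E3) : Prop :=
  ~ bdry_tangent S p w /\
  exists c : R -> E3,
    [/\ c 0 = p, (\forall t \near (0 : R), S2 (c t)),
        (\forall t \near (0 : R), t <= 0 -> S (c t))
      & is_derive (0 : R) 1 c w].

End SphereCalculus.

Section Surface.
Context {R : realType}.
Local Notation E3 := 'rV[R]_3.
Local Notation E4 := 'rV[R]_4.
Local Notation S2 := (@usphere R 3).
Variable f : E3 -> E4.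

Definition metric (p v w : E3) : R := dot (sphere_diff f p v) (sphere_diff f p w).

Definition orthonormal_frame (p e1 e2 : E3) : Prop :=
  [/\ sphere_tangent p e1, sphere_tangent p e2,
      metric p e1 e1 = 1, metric p e2 e2 = 1 & metric p e1 e2 = 0].

(* The common value of b(e1,e1) + b(e2,e2) over all orthonormal frames. *)
Definition metric_trace {W : normedModType R} (p : E3) (b : E3 -> E3 -> W) : W :=
  xget 0 [set T | forall e1 e2, orthonormal_frame p e1 e2 ->
                  T = b e1 e1 + b e2 e2].

Definition tangential (p : E3) (u : E4) : E4 :=
  xget 0 [set T | (exists2 v, sphere_tangent p v & T = sphere_diff f p v) /\
                  (forall w, sphere_tangent p w ->
                     dot (u - T) (sphere_diff f p w) = 0)].

(* Tangent vector fields along the surface are maps X into R^4; their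
   covariant derivative for the induced metric is the tangential part of the
   flat derivative (Gauss formula). *)
Definition nabla (X : E3 -> E4) (p v : E3) : E4 := tangential p (sphere_diff X p v).

(* Normal part of the flat derivative, in the direction v, of the tangent field
   df(W), where W = sphere_tan_proj _ w is a tangent field extending w. *)
Definition second_form (p v w : E3) : E4 :=
  let D := sphere_diff (fun q => sphere_diff f q (sphere_tan_proj q w)) p v in
  D - tangential p D.

Definition mean_curvature (p : E3) : E4 := metric_trace p (second_form p).

Definition divergence (X : E3 -> E4) (p : E3) : R :=
  metric_trace p (fun v w => dot (nabla X p v) (sphere_diff f p w) : R^o).

Definition conformal_maslov_form (S : set E3) : Prop :=
  let JH := fun q => Jc (mean_curvature q) in
  forall p v w, S p -> sphere_tangent p v -> sphere_tangent p w ->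
    divergence JH p * metric p v w
      - 2 * dot (nabla JH p v) (sphere_diff f p w) = 0.

Definition immersed_surface (S : set E3) : Prop :=
  [/\ smooth_domain S, sphere_smooth f
    & forall p v, S p -> sphere_tangent p v -> sphere_diff f p v = 0 -> v = 0].

Definition lagrangian_surface (S : set E3) : Prop :=
  immersed_surface S /\
  forall p v w, S p -> sphere_tangent p v -> sphere_tangent p w ->
    omega0 (sphere_diff f p v) (sphere_diff f p w) = 0.

Definition in_unit_ball (S : set E3) : Prop :=
  f @` S `<=` @cball R 4 /\ f @` bdry S `<=` @usphere R 4.

(* The outward unit normal of the unit sphere of R^4 at f p is f p itself. *)
Definition legendrian_boundary (S : set E3) : Prop :=
  forall p v, bdry S p -> bdry_tangent S p v ->
    dot (Jc (f p)) (sphere_diff f p v) = 0.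

Definition outward_unit_conormal (S : set E3) (p : E3) (mu : E4) : Prop :=
  exists w, [/\ outward S p w, mu = sphere_diff f p w, dot mu mu = 1
    & forall v, bdry_tangent S p v -> dot mu (sphere_diff f p v) = 0].

Definition contact_angle (S : set E3) (p : E3) (theta : R) : Prop :=
  0 <= theta < pi /\
  outward_unit_conormal S p (sin theta *: f p + cos theta *: Jc (f p)).

(* A constant contact angle is meant for connected S.  The two components of
   whitney_region r have contact angles theta and pi - theta, with
   cos theta = 1 / r^2 > 0, because complex conjugation exchanges their images
   and reverses Jc. *)
Definition legendrian_capillary_boundary (S : set E3) : Prop :=
  [/\ in_unit_ball S, legendrian_boundary S
    & exists theta : R, forall p, bdry S p -> contact_angle S p theta].

End Surface.

Section Whitney.
Context {R : realType}.

Definition whitney (r : R) (q : 'rV[R]_3) : 'rV[R]_4 :=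
  (r / (1 + q 0 2 ^+ 2)) *:
    \row_i [:: q 0 0; q 0 1; q 0 0 * q 0 2; q 0 1 * q 0 2]`_i.

(* The part of the sphere that f_{r,0} maps into the closed unit ball, i.e.
   the abstract surface underlying the intersection of the image with it. *)
Definition whitney_region (r : R) : set 'rV[R]_3 :=
  @usphere R 3 `&` whitney r @^-1` (@cball R 4).

End Whitney.

(* Main.v *)
Require Import Defs.
From HB Require Import structures.
From mathcomp Require Import all_boot all_order all_algebra.
From mathcomp Require Import all_classical all_reals all_analysis.
From mathcomp Require Import ring lra.

Set Implicit Arguments.
Unset Strict Implicit.
Unset Printing Implicit Defensive.

Import Order.TTheory GRing.Theory Num.Theory.
Import numFieldNormedType.Exports.
Local Open Scope classical_set_scope.
Local Open Scope ring_scope.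

(** Write a point of the sphere as (x_1, x_2, c) and identify the target with
    the complexification of R^2.  Then the Whitney sphere is the real vector
    (x_1, x_2) multiplied by the complex number u(c) = r / (1 - i c): it is
    swept out by rotating the plane curve sqrt (1 - c^2) u(c).  Every object
    attached to it inherits this shape, so all computations reduce to
    one-variable identities between rational functions of c.

    - The differential at p is v |-> v_3 u'(c) (x_1, x_2) + u(c) (v_1, v_2)
      (sphere_diff_whitney).  Real parts of products give the induced metric,
      which is the round one times r^2 / (1 + c^2) (dot_dwhitney), and
      imaginary parts give the vanishing of the symplectic form
      (omega0_dwhitney).
    - Since the metric is conformal to the round one, the mean curvature is the
      spherical Laplacian of the immersion divided by the conformal factor.
      Differentiating twice along the sphere and tracing over a frame yields
      H = - (4 / r) (1 + i c) / (1 - i c)^2 (x_1, x_2) (mean_curvatureE).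
    - The field JH is again a profile times (x_1, x_2); the symmetric bilinear
      form v, w |-> <nabla_v JH, w> turns out to be a multiple of the metric
      (nabla_JH), and its trace is then twice that multiple, which is
      exactly the conformality of the Maslov form.

    The squared norm of the image point is r^2 (1 - c^2) / (1 + c^2), so it is
    at most 1 iff c^2 >= k^2 with k^2 = (r^2 - 1) / (r^2 + 1), which lies
    strictly between 0 and 1: the region is the union of two disjoint closed
    polar caps (region_caps).  Along the boundary circles c = +- k the
    immersion maps the outward normal of the cap of length sqrt (1 - k^2) to a
    unit vector in the span of N and JN, with sin theta = 2 k / (1 + k^2) and
    cos theta = -+ (1 - k^2) / (1 + k^2) (dwhitney_cap_normal); these depend
    on the cap only.  Finally each cap projects orthogonally onto a disk of
    the equatorial plane, and the immersion is injective on it because the norm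
    of the image determines |c|; this gives the two families of homeomorphisms
    (cap_disk, cap_image_disk), and connectedness of the caps identifies them
    with the components. *)

(** * Directional derivatives *)

(** A directional derivative is a derivative of a function of one real
    variable, which is how the one-variable chain rule and the derivative of
    the square root become available on normed spaces. *)
Lemma is_derive_line (R : realType) (V W : normedModType R) (f : V -> W)
    (x v : V) (df : W) :
  is_derive x v f df <-> is_derive (0 : R) 1 (fun t : R => f (t *: v + x)) df.
Proof.
have slopeE : (fun h : R => h^-1 *: ((f \o shift x) (h *: v) - f x)) =
    (fun h : R => h^-1 *: (((fun t : R => f (t *: v + x)) \o shift 0) (h *: 1) -
                           f (0 *: v + x))).
  by apply/funext => h /=; rewrite addr0 scale0r add0r [_%:A]mulr1.
split=> -[fd fE]; split.
- exact: (derivable1P f x v).1 fd.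
- by rewrite -fE /derive slopeE.
- exact: (derivable1P f x v).2 fd.
- by rewrite -fE /derive slopeE.
Qed.

Lemma is_derive_chain (R : realType) (V : normedModType R) (g : R -> R)
    (f : V -> R^o) (x v : V) (df dg : R) :
  is_derive x v f df -> is_derive (f x : R) 1 g dg ->
  is_derive x v (fun y => g (f y) : R^o) (dg * df).
Proof.
move=> /is_derive_line fd gd; apply/is_derive_line.
apply: (@is_derive1_comp _ g (fun t : R => f (t *: v + x))) => //.
by rewrite scale0r add0r.
Qed.

Lemma is_derive_rowP (R : realType) (V : normedModType R) n
    (F : V -> 'rV[R]_n) (x v : V) (d : 'rV[R]_n) :
  (forall i, is_derive x v (fun y => F y 0 i : R^o) (d 0 i)) ->
  is_derive x v F d.
Proof.
move=> Fd.
have Fx : derivable F x v.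
  by apply/derivable_mxP => i j; rewrite [i]ord1; case: (Fd j).
split=> //; rewrite derive_mx //; apply/rowP => j; rewrite mxE.
by case: (Fd j).
Qed.

Lemma continuous_rowP (R : realType) (T : topologicalType) n
    (F : T -> 'rV[R]_n) (x : T) :
  (forall i, {for x, continuous (fun y => F y 0 i : R^o)}) ->
  {for x, continuous F}.
Proof.
move=> Fc; apply/cvg_ballP => e e0; near=> y; split=> // i j.
rewrite [i]ord1; move: j; near: y; apply: filter_forall => j.
by have /cvg_ballP := Fc j; apply.
Unshelve. all: by end_near. Qed.

(** * Stability of the classes C^n *)

Section Smooth.
Context {R : realType} {V : normedModType R} (U : set V) (oU : open U).

(** The class is defined through total functions but only sees their values on
    the open set U, where equality propagates to all derivatives. *)
Lemma Cn_ext n (W : normedModType R) (f g : V -> W) :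
  (forall x, U x -> f x = g x) -> Cn n U f -> Cn n U g.
Proof.
elim: n f g => [|n IHn] f g fg.
all: have fg_near x : U x -> \forall y \near x, f y = g y
       by move=> Ux; near=> y; apply: fg; near: y; exact: open_nbhs_nbhs.
all: have gc : (forall x, U x -> {for x, continuous f}) ->
       forall x, U x -> {for x, continuous g}
       by (move=> fc x Ux; rewrite /prop_for /continuous_at -(fg _ Ux);
           apply: cvg_trans (fc x Ux);
           apply: near_eq_cvg; apply: filterS (fg_near x Ux) => y ->).
  by case=> fc _; split=> //; exact: gc.
case=> fc [fd fD]; split; first exact: gc.
split=> [x v Ux|v]; first exact: (near_eq_derivable (fg_near x Ux) (fd x v Ux)).
apply: IHn (fD v) => x Ux; exact: near_eq_derive (fg_near x Ux).
Unshelve. all: by end_near. Qed.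

Lemma Cn_S n (W : normedModType R) (f : V -> W) : Cn n.+1 U f -> Cn n U f.
Proof.
elim: n f => [|n IHn] f [fc]; first by split.
by case=> fd fD; split=> //; split=> // v; apply: IHn.
Qed.

(** The induction step of every stability result below: it suffices to exhibit
    some formula for the directional derivatives which is itself of class
    C^n on U. *)
Lemma Cn_intro n (W : normedModType R) (f : V -> W) (df : V -> V -> W) :
  (forall x, U x -> {for x, continuous f}) ->
  (forall x v, U x -> is_derive x v f (df v x)) ->
  (forall v, Cn n U (df v)) -> Cn n.+1 U f.
Proof.
move=> fc fd fD; split=> //; split=> [x v Ux|v]; first by case: (fd x v Ux).
by apply: Cn_ext (fD v) => x Ux; case: (fd x v Ux).
Qed.

Lemma Cn_continuous n (W : normedModType R) (f : V -> W) x :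
  Cn n U f -> U x -> {for x, continuous f}.
Proof. by case: n => [|n] [fc _]; exact: fc. Qed.

Lemma Cn_is_derive n (W : normedModType R) (f : V -> W) x v :
  Cn n.+1 U f -> U x -> is_derive x v f ('D_v f x).
Proof. by case=> _ [fd _] Ux; apply/derivableP/fd. Qed.

Lemma Cn_derive n (W : normedModType R) (f : V -> W) v :
  Cn n.+1 U f -> Cn n U (fun x => 'D_v f x).
Proof. by case=> _ [_ fD]; exact: fD. Qed.

Lemma Cn_cst n (W : normedModType R) (a : W) : Cn n U (fun=> a).
Proof.
elim: n a => [|n IHn] a; first by split=> // x _; exact: cvg_cst.
apply: (@Cn_intro _ _ _ (fun _ _ => 0)) => [x _|v].
- exact: cvg_cst.
- exact: IHn.
Qed.

Lemma CnD n (f g : V -> R^o) :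
  Cn n U f -> Cn n U g -> Cn n U (fun x => f x + g x : R^o).
Proof.
elim: n f g => [|n IHn] f g fn gn.
all: have c x : U x -> {for x, continuous (fun x => f x + g x : R^o)}
  by move=> Ux; apply: cvgD;
    [exact: Cn_continuous fn Ux|exact: Cn_continuous gn Ux].
  by split.
apply: (@Cn_intro _ _ _ (fun v x => 'D_v f x + 'D_v g x)) => //.
  move=> x v Ux; have fd := Cn_is_derive v fn Ux.
  by have gd := Cn_is_derive v gn Ux; exact: (is_deriveD fd gd).
by move=> v; apply: IHn; exact: Cn_derive.
Qed.

Lemma CnM n (f g : V -> R^o) :
  Cn n U f -> Cn n U g -> Cn n U (fun x => f x * g x : R^o).
Proof.
elim: n f g => [|n IHn] f g fn gn.
all: have c x : U x -> {for x, continuous (fun x => f x * g x : R^o)}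
  by move=> Ux; apply: cvgM;
    [exact: Cn_continuous fn Ux|exact: Cn_continuous gn Ux].
  by split.
apply: (@Cn_intro _ _ _ (fun v x => f x * 'D_v g x + g x * 'D_v f x : R^o)) => //.
  move=> x v Ux; have fd := Cn_is_derive v fn Ux.
  by have gd := Cn_is_derive v gn Ux; exact: (is_deriveM fd gd).
by move=> v; apply: CnD; apply: IHn;
  [exact: Cn_S|exact: Cn_derive|exact: Cn_S|exact: Cn_derive].
Qed.

Lemma Cn_sum n (I : Type) (s : seq I) (F : I -> V -> R^o) :
  (forall i, Cn n U (F i)) -> Cn n U (fun x => \sum_(i <- s) F i x : R^o).
Proof.
move=> FC; elim: s => [|i s IHs].
  by apply: Cn_ext (Cn_cst n (0 : R^o)) => x _; rewrite big_nil.
by apply: Cn_ext (CnD (FC i) IHs) => x _; rewrite big_cons.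
Qed.

(** Composition with a one-variable function g whose derivative dg can be
    expressed smoothly through g itself.  The smoothness of dg may be
    derived from that of g at the same order, as for inversion (g' = - g^2)
    and the square root (g' = 1 / (2 g)): each step of the induction on n
    gains one derivative. *)
Lemma Cn_chain n (f : V -> R^o) (g dg : R -> R) :
  (forall x, U x -> is_derive (f x : R) 1 g (dg (f x))) ->
  (forall m, Cn m U f -> Cn m U (fun x => g (f x) : R^o) -> 
     Cn m U (fun x => dg (f x) : R^o)) ->
  Cn n U f -> Cn n U (fun x => g (f x) : R^o).
Proof.
move=> gd dgS; elim: n => [|n IHn] fn.
all: have c x : U x -> {for x, continuous (fun x => g (f x) : R^o)}
  by (move=> Ux; apply: continuous_comp; [exact: Cn_continuous fn Ux|];
      apply: differentiable_continuous; apply/derivable1_diffP; case: (gd x Ux)).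
  by split.
apply: (@Cn_intro _ _ _ (fun v x => dg (f x) * 'D_v f x : R^o)) => //.
  by move=> x v Ux; exact: (is_derive_chain (Cn_is_derive v fn Ux) (gd x Ux)).
by move=> v; apply: CnM; [apply: dgS; [|apply: IHn]; exact: Cn_S|exact: Cn_derive].
Qed.

Lemma CnV n (f : V -> R^o) :
  (forall x, U x -> f x != 0) -> Cn n U f -> Cn n U (fun x => (f x)^-1 : R^o).
Proof.
move=> f0; apply: (@Cn_chain _ _ (fun y => y^-1) (fun y => - (y^-1 * y^-1))).
  move=> x Ux; have := f0 x Ux; move: (f x) => y y0.
  apply: is_derive_eq; first exact: (@is_deriveV R id y 1 1).
  by rewrite /GRing.scale/= mulr1 expr2 invfM.
move=> m fm gm.
have -> : (fun x => - ((f x)^-1 * (f x)^-1) : R^o) =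
          (fun x => (-1) * ((f x)^-1 * (f x)^-1) : R^o).
  by apply/funext => x; rewrite mulN1r.
by apply: CnM; [exact: Cn_cst|exact: CnM].
Qed.

Lemma Cn_sqrt n (f : V -> R^o) :
  (forall x, U x -> 0 < f x) -> Cn n U f ->
  Cn n U (fun x => Num.sqrt (f x) : R^o).
Proof.
move=> f0; apply: (@Cn_chain _ _ (@Num.sqrt R) (fun y => (2 * Num.sqrt y)^-1)).
  by move=> x Ux; apply: is_derive1_sqrt; exact: f0.
move=> m fm gm; apply: CnV => [x Ux|].
  by rewrite mulf_neq0 ?pnatr_eq0// gt_eqF// sqrtr_gt0 f0.
by apply: CnM => //; exact: Cn_cst.
Qed.

Lemma Cn_row n m (F : V -> 'rV[R]_m) :
  (forall i, Cn n U (fun x => F x 0 i : R^o)) -> Cn n U F.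
Proof.
elim: n F => [|n IHn] F Fn.
all: have c x : U x -> {for x, continuous F}
  by move=> Ux; apply: continuous_rowP => i; exact: Cn_continuous (Fn i) Ux.
  by split.
apply: (@Cn_intro _ _ _ (fun v x => \row_i 'D_v (fun y => F y 0 i : R^o) x)) => //.
  move=> x v Ux; apply: is_derive_rowP => i.
  by rewrite mxE; exact: Cn_is_derive.
move=> v; apply: IHn => i.
have -> : (fun x => (\row_j 'D_v (fun y => F y 0 j : R^o) x) 0 i : R^o) =
          (fun x => 'D_v (fun y => F y 0 i : R^o) x).
  by apply/funext => x; rewrite mxE.
exact: Cn_derive.
Qed.

End Smooth.

Lemma Cn_setT_continuous (R : realType) n (V W : normedModType R) (h : V -> W) :
  Cn n setT h -> continuous h.
Proof. by move=> hC x; exact: (Cn_continuous hC). Qed.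

Lemma is_derive_coord (R : realType) n (i : 'I_n) (x v : 'rV[R]_n) :
  is_derive x v (fun y : 'rV[R]_n => y 0 i : R^o) (v 0 i).
Proof.
apply/is_derive_line.
have -> : (fun t : R => (t *: v + x) 0 i : R^o) =
          (fun t : R => t * v 0 i + x 0 i).
  by apply/funext => t; rewrite !mxE.
apply: is_derive_eq.
by rewrite /GRing.scale/= mulr0 add0r mulr1 addr0.
Qed.

Lemma Cn_coord (R : realType) n m (U : set 'rV[R]_n) (i : 'I_n) :
  open U -> Cn m U (fun y : 'rV[R]_n => y 0 i : R^o).
Proof.
move=> oU; case: m => [|m]; first by split=> // x _; exact: coord_continuous.
apply: (@Cn_intro _ _ _ oU _ _ _ (fun v _ => v 0 i : R^o)).
- by move=> x _; exact: coord_continuous.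
- by move=> x v _; exact: is_derive_coord.
- by move=> v; exact: Cn_cst.
Qed.

(** * The inner product in coordinates *)

Section InnerProduct.
Context {R : realType}.

Lemma dotC n (u v : 'rV[R]_n) : dot u v = dot v u.
Proof. by apply: eq_bigr => i _; rewrite mulrC. Qed.

Lemma dotDl n (u v w : 'rV[R]_n) : dot (u + v) w = dot u w + dot v w.
Proof.
by rewrite /dot -big_split; apply: eq_bigr => i _; rewrite mxE mulrDl.
Qed.

Lemma dotZl n a (u v : 'rV[R]_n) : dot (a *: u) v = a * dot u v.
Proof.
by rewrite /dot mulr_sumr; apply: eq_bigr => i _; rewrite mxE mulrA.
Qed.

Lemma dotDr n (u v w : 'rV[R]_n) : dot u (v + w) = dot u v + dot u w.
Proof. by rewrite dotC dotDl !(dotC u). Qed.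

Lemma dotZr n a (u v : 'rV[R]_n) : dot u (a *: v) = a * dot u v.
Proof. by rewrite dotC dotZl dotC. Qed.

Lemma dotBl n (u v w : 'rV[R]_n) : dot (u - v) w = dot u w - dot v w.
Proof. by rewrite dotDl -scaleN1r dotZl mulN1r. Qed.

Lemma dotBr n (u v w : 'rV[R]_n) : dot u (v - w) = dot u v - dot u w.
Proof. by rewrite dotC dotBl !(dotC u). Qed.

Lemma dot_ge0 n (u : 'rV[R]_n) : 0 <= dot u u.
Proof. by apply: sumr_ge0 => i _; rewrite -expr2 sqr_ge0. Qed.

Lemma dot_eq0 n (u : 'rV[R]_n) : dot u u = 0 -> u = 0.
Proof.
move=> /eqP; rewrite psumr_eq0 => [/allP u0|i _]; last by rewrite -expr2 sqr_ge0.
apply/rowP => i; rewrite mxE; apply/eqP.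
by have := u0 i (mem_index_enum i); rewrite /= mulf_eq0 orbb.
Qed.

Lemma dot_gt0 n (u : 'rV[R]_n) : u != 0 -> 0 < dot u u.
Proof.
move=> u0; rewrite lt_def dot_ge0 andbT.
by apply: contra u0 => /eqP /dot_eq0 ->.
Qed.

Lemma dot2 (u v : 'rV[R]_2) : dot u v = u 0 0 * v 0 0 + u 0 1 * v 0 1.
Proof.
rewrite /dot !big_ord_recl big_ord0 addr0.
by congr (_ + _); congr (u 0 _ * v 0 _); exact: val_inj.
Qed.

Lemma dot3 (u v : 'rV[R]_3) :
  dot u v = u 0 0 * v 0 0 + u 0 1 * v 0 1 + u 0 2 * v 0 2.
Proof.
rewrite /dot !big_ord_recl big_ord0 addr0 addrA.
by congr (_ + _ + _); congr (u 0 _ * v 0 _); exact: val_inj.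
Qed.

Lemma dot4 (u v : 'rV[R]_4) :
  dot u v = u 0 0 * v 0 0 + u 0 1 * v 0 1 + u 0 2 * v 0 2 + u 0 3 * v 0 3.
Proof.
rewrite /dot !big_ord_recl big_ord0 addr0 !addrA.
by congr (_ + _ + _ + _); congr (u 0 _ * v 0 _); exact: val_inj.
Qed.

(** The numerals 0, 1, 2, 3 in ordinal types denote elements of cyclic groups;
    these case principles present every index in that form. *)
Lemma ord2P (P : 'I_2 -> Prop) : P 0 -> P 1 -> forall i, P i.
Proof. by move=> P0 P1 [[|[|//]] h]; [move: P0|move: P1];
  congr P; exact: val_inj. Qed.

Lemma ord3P (P : 'I_3 -> Prop) : P 0 -> P 1 -> P 2 -> forall i, P i.
Proof. by move=> P0 P1 P2 [[|[|[|//]]] h]; [move: P0|move: P1|move: P2];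
  congr P; exact: val_inj. Qed.

Lemma ord4P (P : 'I_4 -> Prop) : P 0 -> P 1 -> P 2 -> P 3 -> forall i, P i.
Proof. by move=> P0 P1 P2 P3 [[|[|[|[|//]]]] h];
  [move: P0|move: P1|move: P2|move: P3]; congr P; exact: val_inj. Qed.

End InnerProduct.

(** * Differentiation along the unit sphere *)

Section SphereRules.
Context {R : realType}.
Local Notation E3 := 'rV[R]_3.
Local Notation S2 := (@usphere R 3).

Lemma sphere_projE (q : E3) : S2 q -> sphere_proj q = q.
Proof. by move=> qS; rewrite /sphere_proj qS sqrtr1 invr1 scale1r. Qed.

Lemma sphere_proj_sphere (x : E3) : x != 0 -> S2 (sphere_proj x).
Proof.
move=> /dot_gt0 x0; rewrite /usphere/= /sphere_proj dotZl dotZr.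
rewrite mulrA -expr2 exprVn sqr_sqrtr ?mulVf ?gt_eqF//; exact: ltW.
Qed.

(** Moving along a tangent direction does not change the norm to first order,
    and never decreases it: the line p + t v avoids the origin, and its radial
    projection is a curve on the sphere with velocity v at p. *)
Lemma dot_line (p v : E3) (t : R) : S2 p -> sphere_tangent p v ->
  dot (t *: v + p) (t *: v + p) = 1 + t ^+ 2 * dot v v.
Proof.
move=> pS pv; have vp : dot v p = 0 by rewrite dotC.
by rewrite dotDl !dotDr !dotZl !dotZr pS pv vp; ring.
Qed.

Lemma line_neq0 (p v : E3) (t : R) : S2 p -> sphere_tangent p v ->
  t *: v + p != 0.
Proof.
move=> pS pv; apply/eqP => tvp0; have := dot_line t pS pv.
rewrite tvp0 /dot big1 => [|i _]; last by rewrite mxE mul0r.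
move/eqP; rewrite eq_sym gt_eqF// ltr_wpDr// mulr_ge0 ?sqr_ge0//.
exact: dot_ge0.
Qed.

(** The differential along the sphere only depends on the values on the sphere.
    This is what allows a field given by a choice-based definition, such as
    the mean curvature, to be replaced by a closed formula before
    differentiating. *)
Lemma sphere_diff_unique (W : normedModType R) (g h : E3 -> W) (p v : E3) d :
  S2 p -> sphere_tangent p v -> (forall q, S2 q -> g q = h q) ->
  is_derive p v (h \o sphere_proj) d -> sphere_diff g p v = d.
Proof.
move=> pS pv gh /is_derive_line hd.
suff gd : is_derive (0 : R) 1
    (fun t : R => (g \o sphere_proj) (t *: v + p)) d.
  by have [] := (is_derive_line (g \o sphere_proj) p v d).2 gd.
have -> // : (fun t : R => (g \o sphere_proj) (t *: v + p)) =
          (fun t : R => (h \o sphere_proj) (t *: v + p)).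
apply/funext => t; apply: gh; apply: sphere_proj_sphere; exact: line_neq0.
Qed.

(** The scalar counterpart of sphere_diff, as a relation rather than a value so
    that the rules of calculus below compose without differentiability side
    conditions. *)
Definition sderive (p v : E3) (g : E3 -> R) (d : R) : Prop :=
  is_derive p v (fun x => g (sphere_proj x) : R^o) d.

Section Rules.
Variables (p v : E3) (pS : S2 p) (pv : sphere_tangent p v).

Lemma sderive_eq g d d' : sderive p v g d -> d = d' -> sderive p v g d'.
Proof. by move=> gd <-. Qed.

Lemma sderive_ext f g d :
  (forall q, f q = g q) -> sderive p v f d -> sderive p v g d.
Proof. by move=> /funext ->. Qed.

Lemma sderive_cst (a : R) : sderive p v (fun=> a) 0.
Proof. exact: is_derive_cst. Qed.

Lemma sderiveD f g df dg : sderive p v f df -> sderive p v g dg ->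
  sderive p v (fun q => f q + g q) (df + dg).
Proof. by move=> fd gd; exact: (is_deriveD fd gd). Qed.

Lemma sderiveN f df : sderive p v f df -> sderive p v (fun q => - f q) (- df).
Proof. by move=> fd; exact: (is_deriveN fd). Qed.

Lemma sderiveM f g df dg : sderive p v f df -> sderive p v g dg ->
  sderive p v (fun q => f q * g q) (f p * dg + g p * df).
Proof.
by move=> fd gd; have := is_deriveM fd gd; rewrite (sphere_projE pS).
Qed.

Lemma sderive_chain (g : R -> R) f df dg : sderive p v f df ->
  is_derive (f p : R) 1 g dg -> sderive p v (fun q => g (f q)) (dg * df).
Proof.
by move=> fd gd; apply: (is_derive_chain fd); rewrite (sphere_projE pS).
Qed.

Lemma sderiveV f df : f p != 0 -> sderive p v f df ->
  sderive p v (fun q => (f q)^-1) (- (f p) ^- 2 * df).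
Proof.
move=> fp fd; apply: (sderive_chain fd).
apply: is_derive_eq; first exact: (@is_deriveV R id (f p) 1 1).
by rewrite /GRing.scale/= mulr1.
Qed.

Lemma sderiveX n f df : sderive p v f df ->
  sderive p v (fun q => f q ^+ n) (n%:R * f p ^+ n.-1 * df).
Proof.
by move=> fd; have := is_deriveX n fd; rewrite exprfctE (sphere_projE pS).
Qed.

(** The basic case: radial projection fixes tangent directions to first order,
    because the factor 1 / sqrt (1 + t^2 |v|^2) is stationary at t = 0. *)
Lemma sderive_coord i : sderive p v (fun q => q 0 i) (v 0 i).
Proof.
apply/is_derive_line.
have -> : (fun t : R => sphere_proj (t *: v + p) 0 i : R^o) =
    (fun t : R => (Num.sqrt (1 + t ^+ 2 * dot v v))^-1 * (t * v 0 i + p 0 i)).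
  by apply/funext => t; rewrite mxE dot_line// !mxE.
have rad : is_derive (0 : R) 1 (fun t : R => 1 + t ^+ 2 * dot v v) 0.
  by apply: is_derive_eq; rewrite /GRing.scale/=; ring.
have sq : is_derive (0 : R) 1 (fun t : R => Num.sqrt (1 + t ^+ 2 * dot v v)) 0.
  apply: is_derive_eq.
    apply: (@is_derive1_comp _ (@Num.sqrt R) _ _ _ _ _ rad).
    by apply: is_derive1_sqrt; rewrite expr0n mul0r addr0.
  by rewrite mulr0.
have sq0 : Num.sqrt (1 + (0 : R) ^+ 2 * dot v v) = 1.
  by rewrite expr0n mul0r addr0 sqrtr1.
have inv : is_derive (0 : R) 1
    (fun t : R => (Num.sqrt (1 + t ^+ 2 * dot v v))^-1) 0.
  apply: is_derive_eq; first by apply: (is_deriveV _ sq); rewrite sq0 oner_eq0.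
  by rewrite /GRing.scale/= mulr0.
have lin : is_derive (0 : R) 1 (fun t : R => t * v 0 i + p 0 i) (v 0 i).
  by apply: is_derive_eq; rewrite /GRing.scale/=; ring.
have := is_deriveM inv lin.
by rewrite sq0 /GRing.scale/= invr1 mulr0 addr0 mul1r.
Qed.

End Rules.
End SphereRules.

Ltac sderive_rules pS pv :=
  repeat first
    [ apply: (sderive_coord pS pv) | apply: sderive_cst
    | apply: sderiveD | apply: sderiveN | apply: (sderiveM pS)
    | apply: (sderiveX pS) | apply: (sderiveV pS) ].

(** * Complex multiples of real vectors *)

Section ComplexTimesReal.
Context {R : realType}.

(** The complex number s + i t times the real vector (a, b), in the coordinates
    (x_1, x_2, y_1, y_2). *)
Definition cvec (s t a b : R) : 'rV[R]_4 :=
  \row_i [:: s * a; s * b; t * a; t * b]`_i.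

Lemma dot_cvec s t a b s' t' a' b' :
  dot (cvec s t a b) (cvec s' t' a' b') =
  (s * s' + t * t') * (a * a' + b * b').
Proof. by rewrite dot4 !mxE /=; ring. Qed.

Lemma Jc_cvec s t a b : Jc (cvec s t a b) = cvec (- t) s a b.
Proof. by apply/rowP; apply: ord4P; rewrite !mxE /= ?mxE /= ?mulNr. Qed.

Lemma cvecZ k s t a b : k *: cvec s t a b = cvec (k * s) (k * t) a b.
Proof. by apply/rowP; apply: ord4P; rewrite !mxE /= ?mulrA. Qed.

Lemma cvecD s t s' t' a b :
  cvec s t a b + cvec s' t' a b = cvec (s + s') (t + t') a b.
Proof. by apply/rowP; apply: ord4P; rewrite !mxE /= mulrDl. Qed.

Lemma sderive_cvec (p v : 'rV[R]_3) (S T A B : 'rV[R]_3 -> R) dS dT dA dB :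
  usphere p ->
  sderive p v S dS -> sderive p v T dT -> sderive p v A dA -> sderive p v B dB ->
  is_derive p v ((fun q => cvec (S q) (T q) (A q) (B q)) \o sphere_proj)
    (cvec dS dT (A p) (B p) + cvec (S p) (T p) dA dB).
Proof.
move=> pS Sd Td Ad Bd; apply: is_derive_rowP.
pose F q := cvec (S q) (T q) (A q) (B q).
have entry i f d d' : (forall q, f q = F q 0 i) -> d = d' ->
    sderive p v f d -> sderive p v (fun q => F q 0 i) d'.
  by move=> fF <-; exact: sderive_ext.
apply: ord4P.
- apply: (entry _ _ _ _ _ _ (sderiveM pS Sd Ad)) => [q|]; rewrite !mxE//=; ring.
- apply: (entry _ _ _ _ _ _ (sderiveM pS Sd Bd)) => [q|]; rewrite !mxE//=; ring.
- apply: (entry _ _ _ _ _ _ (sderiveM pS Td Ad)) => [q|]; rewrite !mxE//=; ring.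
- apply: (entry _ _ _ _ _ _ (sderiveM pS Td Bd)) => [q|]; rewrite !mxE//=; ring.
Qed.

End ComplexTimesReal.

(** * Profile functions of the Whitney sphere *)

Section Profiles.
Context {R : realType}.
Variable r : R.
Hypothesis r0 : r != 0.

(** With u(c) = r / (1 - i c), the functions prof, dprof and ddprof are the real
    and imaginary parts of u, u' and u''; JH_re and JH_im are those of the
    profile - (4 / r) i (1 + i c) / (1 - i c)^2 of the field JH, and dJH_re,
    dJH_im those of its derivative.  Denominators are made real, so that they
    are powers of 1 + c^2. *)
Definition prof_re (c : R) : R := r / (1 + c ^+ 2).
Definition prof_im (c : R) : R := r * c / (1 + c ^+ 2).
Definition dprof_re (c : R) : R := - 2 * r * c / (1 + c ^+ 2) ^+ 2.
Definition dprof_im (c : R) : R := r * (1 - c ^+ 2) / (1 + c ^+ 2) ^+ 2.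
Definition ddprof_re (c : R) : R := - 2 * r * (1 - 3 * c ^+ 2) / (1 + c ^+ 2) ^+ 3.
Definition ddprof_im (c : R) : R := - 2 * r * (3 * c - c ^+ 3) / (1 + c ^+ 2) ^+ 3.
Definition JH_re (c : R) : R := 4 / r * (3 * c - c ^+ 3) / (1 + c ^+ 2) ^+ 2.
Definition JH_im (c : R) : R := - (4 / r) * (1 - 3 * c ^+ 2) / (1 + c ^+ 2) ^+ 2.
Definition dJH_re (c : R) : R :=
  4 / r * (3 - 12 * c ^+ 2 + c ^+ 4) / (1 + c ^+ 2) ^+ 3.
Definition dJH_im (c : R) : R := 4 / r * (10 * c - 6 * c ^+ 3) / (1 + c ^+ 2) ^+ 3.

Lemma den_gt0 (c : R) : 0 < 1 + c ^+ 2.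
Proof. by rewrite ltr_wpDr ?sqr_ge0. Qed.

Lemma den_neq0 (c : R) : 1 + c ^+ 2 != 0.
Proof. by rewrite gt_eqF ?den_gt0. Qed.

Variables (p v : 'rV[R]_3) (pS : usphere p) (pv : sphere_tangent p v).
Local Notation c := (p 0 2).

Ltac profile := (apply: sderive_eq;
  [by sderive_rules pS pv; rewrite ?expf_neq0 ?den_neq0
  |rewrite /=; field; rewrite ?r0 ?den_neq0 ?andbT//]).

Lemma sderive_prof_re : sderive p v (fun q => prof_re (q 0 2)) (dprof_re c * v 0 2).
Proof. rewrite /prof_re /dprof_re; profile. Qed.

Lemma sderive_prof_im : sderive p v (fun q => prof_im (q 0 2)) (dprof_im c * v 0 2).
Proof. rewrite /prof_im /dprof_im; profile. Qed.

Lemma sderive_dprof_re :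
  sderive p v (fun q => dprof_re (q 0 2)) (ddprof_re c * v 0 2).
Proof. rewrite /dprof_re /ddprof_re; profile. Qed.

Lemma sderive_dprof_im :
  sderive p v (fun q => dprof_im (q 0 2)) (ddprof_im c * v 0 2).
Proof. rewrite /dprof_im /ddprof_im; profile. Qed.

Lemma sderive_JH_re : sderive p v (fun q => JH_re (q 0 2)) (dJH_re c * v 0 2).
Proof. rewrite /JH_re /dJH_re; profile. Qed.

Lemma sderive_JH_im : sderive p v (fun q => JH_im (q 0 2)) (dJH_im c * v 0 2).
Proof. rewrite /JH_im /dJH_im; profile. Qed.

End Profiles.

(** * First-order jets of rotationally equivariant maps *)

Section Jets.
Context {R : realType}.
Local Notation E3 := 'rV[R]_3.
Local Notation S2 := (@usphere R 3).

(** The differential at p, in the direction v, of the map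
    q |-> z(q_3) (q_1, q_2), where z and z' take the values s + i t and
    s' + i t' at p_3. *)
Definition jet (s' t' s t : R) (p v : E3) : 'rV[R]_4 :=
  cvec (s' * v 0 2) (t' * v 0 2) (p 0 0) (p 0 1) + cvec s t (v 0 0) (v 0 1).

Lemma sphere_coordsE (p : E3) : S2 p ->
  p 0 0 * p 0 0 + p 0 1 * p 0 1 = 1 - p 0 2 ^+ 2.
Proof. by rewrite /usphere/= dot3 => <-; ring. Qed.

Lemma tangent_coordsE (p v : E3) : sphere_tangent p v ->
  p 0 0 * v 0 0 + p 0 1 * v 0 1 = - (p 0 2 * v 0 2).
Proof. by rewrite /sphere_tangent dot3 => /eqP; rewrite addr_eq0 => /eqP. Qed.

Lemma jetD s' t' s t (p v w : E3) :
  jet s' t' s t p (v + w) = jet s' t' s t p v + jet s' t' s t p w.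
Proof. by apply/rowP; apply: ord4P; rewrite !mxE/=; ring. Qed.

Lemma jetZ s' t' s t a (p v : E3) :
  jet s' t' s t p (a *: v) = a *: jet s' t' s t p v.
Proof. by apply/rowP; apply: ord4P; rewrite !mxE/=; ring. Qed.

Lemma Jc_jet s' t' s t (p v : E3) :
  Jc (jet s' t' s t p v) = jet (- t') s' (- t) s p v.
Proof. by apply/rowP; apply: ord4P; rewrite !mxE/= ?mxE/=; ring. Qed.

Lemma omega0E (u v : 'rV[R]_4) : omega0 u v = dot (Jc u) v.
Proof. by rewrite /omega0 dot4 !mxE/=; ring. Qed.

(** The relations |p| = 1 and <p, v> = <p, w> = 0 eliminate the first two
    coordinates: what is left is a combination of v_3 w_3 and <v, w> whose
    coefficients only involve the profiles.  The bilinear form is a multiple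
    of the round metric as soon as the coefficient of v_3 w_3 vanishes. *)
Lemma dot_jet s' t' s t x' y' x y (p v w : E3) :
  S2 p -> sphere_tangent p v -> sphere_tangent p w ->
  dot (jet s' t' s t p v) (jet x' y' x y p w) =
  ((1 - p 0 2 ^+ 2) * (s' * x' + t' * y') - p 0 2 * (s' * x + t' * y)
    - p 0 2 * (s * x' + t * y') - (s * x + t * y)) * (v 0 2 * w 0 2)
  + (s * x + t * y) * dot v w.
Proof.
move=> pS pv pw; rewrite /jet dotDl !dotDr !dot_cvec sphere_coordsE//.
rewrite (tangent_coordsE pw) (mulrC (v 0 0) (p 0 0)) (mulrC (v 0 1) (p 0 1)).
by rewrite (tangent_coordsE pv) dot3; ring.
Qed.

Lemma dot_cvec_jet s t x' y' x y (p w : E3) : S2 p -> sphere_tangent p w ->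
  dot (cvec s t (p 0 0) (p 0 1)) (jet x' y' x y p w) =
  ((1 - p 0 2 ^+ 2) * (s * x' + t * y') - p 0 2 * (s * x + t * y)) * w 0 2.
Proof.
move=> pS pw; rewrite /jet dotDr !dot_cvec sphere_coordsE//.
by rewrite (tangent_coordsE pw); ring.
Qed.

Lemma is_derive_profile (p v : E3) (s t : R -> R) (ds dt : R) :
  S2 p -> sphere_tangent p v ->
  sderive p v (fun q => s (q 0 2)) (ds * v 0 2) ->
  sderive p v (fun q => t (q 0 2)) (dt * v 0 2) ->
  is_derive p v
    ((fun q => cvec (s (q 0 2)) (t (q 0 2)) (q 0 0) (q 0 1)) \o sphere_proj)
    (jet ds dt (s (p 0 2)) (t (p 0 2)) p v).
Proof.
move=> pS pv sd td.
exact: (sderive_cvec pS sd td (sderive_coord pS pv 0) (sderive_coord pS pv 1)).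
Qed.

Lemma sphere_tan_projP (p v : E3) : S2 p -> sphere_tangent p (sphere_tan_proj p v).
Proof.
move=> pS; rewrite /sphere_tangent /sphere_tan_proj dotBr dotZr pS mulr1.
by rewrite dotC subrr.
Qed.

Lemma sphere_tangentD (p v w : E3) :
  sphere_tangent p v -> sphere_tangent p w -> sphere_tangent p (v + w).
Proof. by move=> pv pw; rewrite /sphere_tangent dotDr pv pw addr0. Qed.

Lemma sphere_tangentZ (p v : E3) a :
  sphere_tangent p v -> sphere_tangent p (a *: v).
Proof. by move=> pv; rewrite /sphere_tangent dotZr pv mulr0. Qed.

Lemma sphere_tangentB (p v w : E3) :
  sphere_tangent p v -> sphere_tangent p w -> sphere_tangent p (v - w).
Proof. by move=> pv pw; rewrite /sphere_tangent dotBr pv pw subr0. Qed.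

(** Away from the south pole the frame is the image of the standard basis of the
    plane under the reflection that exchanges the north pole and -p; at the south
    pole the standard basis of the plane itself is used. *)
Lemma round_frame (p : E3) : S2 p -> exists e1 e2 : E3,
  [/\ sphere_tangent p e1, sphere_tangent p e2, dot e1 e1 = 1, dot e2 e2 = 1
    & dot e1 e2 = 0].
Proof.
move=> pS; have := sphere_coordsE pS; set a := p 0 0; set b := p 0 1.
set c := p 0 2 => abc.
pose row3 (x y z : R) : E3 := \row_i [:: x; y; z]`_i.
have [c1|c1] := eqVneq (1 + c) 0.
  have ab0 : a * a + b * b = 0.
    by rewrite abc (_ : c = -1) ?sqrrN ?expr1n ?subrr//; lra.
  have /andP[/eqP a0 /eqP b0] : (a == 0) && (b == 0).
    by move/eqP: ab0; rewrite paddr_eq0 -?expr2 ?sqr_ge0// !sqrf_eq0.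
  exists (row3 1 0 0), (row3 0 1 0).
  rewrite /sphere_tangent !dot3 !mxE/= -/a -/b -/c a0 b0.
  by split; ring.
exists (row3 (1 - a ^+ 2 / (1 + c)) (- a * b / (1 + c)) (- a)).
exists (row3 (- a * b / (1 + c)) (1 - b ^+ 2 / (1 + c)) (- b)).
have -> : b ^+ 2 = 1 - c ^+ 2 - a ^+ 2 by rewrite -abc; ring.
rewrite /sphere_tangent !dot3 !mxE/= -/a -/b -/c.
have bb : b * b = 1 - c ^+ 2 - a ^+ 2 by rewrite -abc; ring.
split.
- transitivity (a * (1 + c - a * a - b * b - c - c * c) / (1 + c)); first by field.
  by rewrite (_ : 1 + c - _ - _ - _ - _ = 0) ?mulr0 ?mul0r// bb; ring.
- by field.
- transitivity (((1 + c - a ^+ 2) ^+ 2 + a ^+ 2 * (b * b) + a ^+ 2 * (1 + c) ^+ 2)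
    / (1 + c) ^+ 2); first by field.
  by rewrite bb; field.
- transitivity ((a ^+ 2 * (b * b) + (a ^+ 2 + c + c ^+ 2) ^+ 2
      + (b * b) * (1 + c) ^+ 2)
    / (1 + c) ^+ 2); first by field.
  by rewrite bb; field.
- by field.
Qed.

(** The matrix with rows p, e1, e2 has a right inverse built from p, e1 / mu,
    e2 / mu; it is also a left inverse, which is the completeness relation.
    It evaluates the trace of any quadratic expression over a frame. *)
Lemma frame_completeness (p e1 e2 : E3) (mu : R) :
  S2 p -> sphere_tangent p e1 -> sphere_tangent p e2 -> mu != 0 ->
  dot e1 e1 = mu -> dot e2 e2 = mu -> dot e1 e2 = 0 ->
  forall i j, e1 0 i * e1 0 j + e2 0 i * e2 0 j =
              mu * ((i == j)%:R - p 0 i * p 0 j).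
Proof.
move=> pS pe1 pe2 mu0 e11 e22 e12 i j.
pose M : 'M[R]_3 := \matrix_(k, l) [:: p 0 l; e1 0 l; e2 0 l]`_k.
pose N : 'M[R]_3 := \matrix_(l, k) [:: p 0 l; mu^-1 * e1 0 l; mu^-1 * e2 0 l]`_k.
have MN : M *m N = 1%:M.
  apply/matrixP => k l; rewrite !mxE.
  pose row_of (x y z : E3) (k : 'I_3) : E3 := [:: x; y; z]`_k.
  transitivity (dot (row_of p e1 e2 k) (row_of p (mu^-1 *: e1) (mu^-1 *: e2) l)).
    apply: eq_bigr => m _; rewrite !mxE; congr (_ * _).
      by move: k; apply: ord3P.
    by move: l; apply: ord3P; rewrite /row_of/= ?mxE.
  move: k l; apply: ord3P; apply: ord3P;
    rewrite /row_of/= ?dotZr ?(dotC e1 p) ?(dotC e2 p) ?(dotC e2 e1);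
    by rewrite ?pS ?pe1 ?pe2 ?e11 ?e22 ?e12 ?mulr0 ?mulVf.
have /matrixP/(_ i j) : N *m M = 1%:M by apply: mulmx1C.
rewrite !mxE !big_ord_recl big_ord0 addr0 !mxE/= => <-.
by field.
Qed.

End Jets.

(** * Metric, mean curvature and Maslov form *)

Section WhitneyGeometry.
Context {R : realType}.
Variables (r : R) (r_gt0 : 0 < r).
Local Notation E3 := 'rV[R]_3.
Local Notation S2 := (@usphere R 3).
Local Notation f := (whitney r).

Let r0 : r != 0. Proof. by rewrite gt_eqF. Qed.

Lemma whitneyE (q : E3) :
  f q = cvec (prof_re r (q 0 2)) (prof_im r (q 0 2)) (q 0 0) (q 0 1).
Proof.
apply/rowP; apply: ord4P; rewrite !mxE/= /prof_re /prof_im; field; exact: den_neq0.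
Qed.

Definition dwhitney (p v : E3) : 'rV[R]_4 :=
  jet (dprof_re r (p 0 2)) (dprof_im r (p 0 2))
    (prof_re r (p 0 2)) (prof_im r (p 0 2)) p v.

Lemma sphere_diff_whitney (p v : E3) : S2 p -> sphere_tangent p v ->
  sphere_diff f p v = dwhitney p v.
Proof.
move=> pS pv; apply: (sphere_diff_unique pS pv (fun q _ => whitneyE q)).
by apply: is_derive_profile => //; [exact: sderive_prof_re|exact: sderive_prof_im].
Qed.

(** The ratio of the induced metric to the round metric. *)
Definition conformal_factor (p : E3) : R := r ^+ 2 / (1 + p 0 2 ^+ 2).

Lemma conformal_factor_gt0 (p : E3) : 0 < conformal_factor p.
Proof. by rewrite divr_gt0 ?exprn_gt0 ?den_gt0. Qed.

Lemma conformal_factor_neq0 (p : E3) : conformal_factor p != 0.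
Proof. by rewrite gt_eqF ?conformal_factor_gt0. Qed.

Lemma dot_dwhitney (p v w : E3) :
  S2 p -> sphere_tangent p v -> sphere_tangent p w ->
  dot (dwhitney p v) (dwhitney p w) = conformal_factor p * dot v w.
Proof.
move=> pS pv pw; rewrite dot_jet//.
rewrite /dprof_re /dprof_im /prof_re /prof_im /conformal_factor.
by field; exact: den_neq0.
Qed.

Lemma metricE (p v w : E3) : S2 p -> sphere_tangent p v -> sphere_tangent p w ->
  metric f p v w = conformal_factor p * dot v w.
Proof. by move=> pS pv pw; rewrite /metric !sphere_diff_whitney ?dot_dwhitney. Qed.

Lemma omega0_dwhitney (p v w : E3) :
  S2 p -> sphere_tangent p v -> sphere_tangent p w ->
  omega0 (dwhitney p v) (dwhitney p w) = 0.
Proof. by move=> pS pv pw; rewrite omega0E Jc_jet dot_jet//; ring. Qed.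

Lemma dwhitney_inj (p v : E3) : S2 p -> sphere_tangent p v ->
  dwhitney p v = 0 -> v = 0.
Proof.
move=> pS pv dv0; apply: dot_eq0; apply: (mulfI (conformal_factor_neq0 p)).
by rewrite mulr0 -dot_dwhitney// dv0 /dot big1 // => i _; rewrite mxE mul0r.
Qed.

Lemma orthonormal_frameP (p e1 e2 : E3) : S2 p ->
  orthonormal_frame f p e1 e2 <->
  [/\ sphere_tangent p e1, sphere_tangent p e2, dot e1 e1 = (conformal_factor p)^-1,
      dot e2 e2 = (conformal_factor p)^-1 & dot e1 e2 = 0].
Proof.
move=> pS; have l0 := conformal_factor_neq0 p; split=> -[pe1 pe2].
  rewrite !metricE// => h1 h2 h3.
  by split=> //; apply: (mulfI l0); rewrite ?mulfV ?mulr0.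
by move=> h1 h2 h3; split=> //; rewrite metricE// ?h1 ?h2 ?h3 ?mulfV ?mulr0.
Qed.

Lemma orthonormal_frame_ex (p : E3) : S2 p ->
  exists e1 e2, orthonormal_frame f p e1 e2.
Proof.
move=> pS; have [e1 [e2 [pe1 pe2 e11 e22 e12]]] := round_frame pS.
pose s := Num.sqrt (conformal_factor p)^-1.
have ss : s * s = (conformal_factor p)^-1.
  by rewrite -expr2 sqr_sqrtr// invr_ge0 ltW ?conformal_factor_gt0.
exists (s *: e1), (s *: e2); apply/(orthonormal_frameP _ _ pS).
rewrite !dotZl !dotZr e11 e22 e12 !mulr1 !mulr0 ss.
by split=> //; exact: sphere_tangentZ.
Qed.

(** Since frames exist, a value that works for all of them is the one picked by
    the definition of the trace. *)
Lemma metric_traceE (W : normedModType R) (p : E3) (b : E3 -> E3 -> W) T :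
  S2 p ->
  (forall e1 e2, orthonormal_frame f p e1 e2 -> T = b e1 e1 + b e2 e2) ->
  metric_trace f p b = T.
Proof.
move=> pS bT; have [e1 [e2 e12]] := orthonormal_frame_ex pS.
have traceP : exists T', forall e1 e2, orthonormal_frame f p e1 e2 ->
    T' = b e1 e1 + b e2 e2 by exists T.
by rewrite (bT _ _ e12); exact: (xgetPex 0 traceP e1 e2 e12).
Qed.

(** The functional w |-> <u, df(w)> is represented by some vector g of R^3; the
    tangential part is the image of the projection of g to the tangent plane of
    the round sphere, divided by the conformal factor. *)
Lemma tangentialP (p : E3) (u : 'rV[R]_4) : S2 p ->
  exists2 v, sphere_tangent p v & tangential f p u = dwhitney p v /\
    forall w, sphere_tangent p w -> dot (u - dwhitney p v) (dwhitney p w) = 0.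
Proof.
move=> pS.
pose g : E3 := \row_k dot u (dwhitney p (delta_mx 0 k)).
have gE w : dot u (dwhitney p w) = dot g w.
  by rewrite dot3 !mxE /dwhitney !dot4 !mxE/=; ring.
pose v := (conformal_factor p)^-1 *: sphere_tan_proj p g.
have pv : sphere_tangent p v by apply: sphere_tangentZ; exact: sphere_tan_projP.
have vP w : sphere_tangent p w -> dot (u - dwhitney p v) (dwhitney p w) = 0.
  move=> pw; rewrite dotBl dot_dwhitney// gE dotZl mulrA.
  rewrite mulfV ?conformal_factor_neq0//.
  by rewrite mul1r /sphere_tan_proj dotBl dotZl pw mulr0 subr0 subrr.
have : exists T, (exists2 v, sphere_tangent p v & T = sphere_diff f p v) /\
    (forall w, sphere_tangent p w -> dot (u - T) (sphere_diff f p w) = 0).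
  exists (dwhitney p v); split; first by exists v; rewrite ?sphere_diff_whitney.
  by move=> w pw; rewrite sphere_diff_whitney ?vP.
move=> /(xgetPex 0) []; rewrite -/(tangential f p u) => -[v' pv' ->] v'P.
exists v' => //; split; first by rewrite sphere_diff_whitney.
by move=> w pw; have := v'P w pw; rewrite !sphere_diff_whitney.
Qed.

Lemma tangential_unique (p : E3) (u : 'rV[R]_4) v :
  S2 p -> sphere_tangent p v ->
  (forall w, sphere_tangent p w -> dot (u - dwhitney p v) (dwhitney p w) = 0) ->
  tangential f p u = dwhitney p v.
Proof.
move=> pS pv vP; have [v' pv' [-> v'P]] := tangentialP u pS.
suff -> : v = v' by [].
have pvv : sphere_tangent p (v - v') by exact: sphere_tangentB.
apply/eqP; rewrite -subr_eq0; apply/eqP/dot_eq0/(mulfI (conformal_factor_neq0 p)).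
rewrite mulr0 dotBl mulrBr -!dot_dwhitney//.
have := vP _ pvv; have := v'P _ pvv; rewrite !dotBl; lra.
Qed.

Lemma tangentialD (p : E3) (u u' : 'rV[R]_4) : S2 p ->
  tangential f p (u + u') = tangential f p u + tangential f p u'.
Proof.
move=> pS; have [v pv [-> vP]] := tangentialP u pS.
have [v' pv' [-> v'P]] := tangentialP u' pS.
rewrite -jetD; apply: tangential_unique => // [|w pw].
  exact: sphere_tangentD.
have := vP w pw; have := v'P w pw.
rewrite /dwhitney jetD !dotBl !dotDl => /eqP + /eqP.
by rewrite !subr_eq0 => /eqP -> /eqP ->; rewrite subrr.
Qed.

Lemma tangential_normal (p : E3) (u : 'rV[R]_4) : S2 p ->
  (forall w, sphere_tangent p w -> dot u (dwhitney p w) = 0) ->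
  tangential f p u = 0.
Proof.
move=> pS un; have d0 : dwhitney p 0 = 0.
  by rewrite -(scale0r (0 : E3)) /dwhitney jetZ scale0r.
rewrite -d0; apply: tangential_unique => //.
  by rewrite /sphere_tangent /dot big1 // => i _; rewrite mxE mulr0.
by move=> w pw; rewrite d0 subr0 un.
Qed.

Lemma dot_tangential (p w : E3) (u : 'rV[R]_4) : S2 p -> sphere_tangent p w ->
  dot (tangential f p u) (dwhitney p w) = dot u (dwhitney p w).
Proof.
move=> pS pw; have [v pv [-> vP]] := tangentialP u pS.
by have /eqP := vP w pw; rewrite dotBl subr_eq0 => /eqP ->.
Qed.

(** The flat derivative, in the direction v, of the image of the tangent field
    extending v; the terms in <v, v> come from the rotation of the tangent
    planes of the round sphere. *)
Definition whitney_hess (p v : E3) : 'rV[R]_4 :=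
  let c := p 0 2 in
  cvec (ddprof_re r c * v 0 2) (ddprof_im r c * v 0 2)
      (v 0 2 * p 0 0) (v 0 2 * p 0 1)
  + cvec (dprof_re r c) (dprof_im r c)
      (2 * v 0 2 * v 0 0 - dot v v * c * p 0 0)
      (2 * v 0 2 * v 0 1 - dot v v * c * p 0 1)
  - cvec (prof_re r c) (prof_im r c) (dot v v * p 0 0) (dot v v * p 0 1).

Lemma sphere_diff_tan_proj (p v : E3) : S2 p -> sphere_tangent p v ->
  sphere_diff (fun q => sphere_diff f q (sphere_tan_proj q v)) p v =
  whitney_hess p v.
Proof.
move=> pS pv.
pose s (q : E3) := v 0 0 * q 0 0 + v 0 1 * q 0 1 + v 0 2 * q 0 2.
pose G (q : E3) :=
  cvec (dprof_re r (q 0 2)) (dprof_im r (q 0 2))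
    ((v 0 2 + - (s q * q 0 2)) * q 0 0) ((v 0 2 + - (s q * q 0 2)) * q 0 1).
pose G' (q : E3) :=
  cvec (prof_re r (q 0 2)) (prof_im r (q 0 2))
    (v 0 0 + - (s q * q 0 0)) (v 0 1 + - (s q * q 0 1)).
apply: (@sphere_diff_unique _ _ _ (fun q => G q + G' q)) => //.
  move=> q qS; rewrite sphere_diff_whitney//; last exact: sphere_tan_projP.
  rewrite /dwhitney /jet /sphere_tan_proj dot3 -/(s q) !mxE.
  by apply/rowP; apply: ord4P; rewrite !mxE/=; ring.
have sp : s p = 0 by rewrite /s -dot3 dotC.
have sd : sderive p v s (dot v v).
  by apply: sderive_eq; [sderive_rules pS pv|rewrite dot3; ring].
have Ad j : sderive p v (fun q => (v 0 2 + - (s q * q 0 2)) * q 0 j)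
    (v 0 2 * v 0 j - dot v v * p 0 2 * p 0 j).
  apply: sderive_eq.
    by apply: (sderiveM pS); [apply: sderiveD; [exact: sderive_cst|
      apply: sderiveN; apply: (sderiveM pS) sd _]|]; exact: sderive_coord.
  by rewrite /= !sp; ring.
have Bd i j : sderive p v (fun q => v 0 i + - (s q * q 0 j))
    (- (dot v v * p 0 j)).
  apply: sderive_eq.
    by apply: sderiveD; [exact: sderive_cst|
      apply: sderiveN; apply: (sderiveM pS) sd _]; exact: sderive_coord.
  by rewrite /= !sp; ring.
have Gd := sderive_cvec pS (sderive_dprof_re r pS pv) (sderive_dprof_im r pS pv)
             (Ad 0) (Ad 1).
have G'd := sderive_cvec pS (sderive_prof_re r pS pv) (sderive_prof_im r pS pv)
             (Bd 0 0) (Bd 1 1).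
apply: (@is_derive_eq _ _ _ _ _ _ _ _ (is_deriveD Gd G'd)).
by apply/rowP; apply: ord4P; rewrite !mxE/= sp; ring.
Qed.

(** The vector - (4 / r) (1 + i c) / (1 - i c)^2 (x_1, x_2): minus i times the
    profile of JH. *)
Definition whitney_H (p : E3) : 'rV[R]_4 :=
  cvec (JH_im r (p 0 2)) (- JH_re r (p 0 2)) (p 0 0) (p 0 1).

(** Tracing turns the profile u of the immersion into
    (1 - c^2) u'' - 4 c u' - 2 u, the spherical Laplacian of u(c) x_j, divided
    by the conformal factor. *)
Lemma whitney_hess_trace (p e1 e2 : E3) : S2 p -> orthonormal_frame f p e1 e2 ->
  whitney_hess p e1 + whitney_hess p e2 = whitney_H p.
Proof.
move=> pS /(orthonormal_frameP _ _ pS)[pe1 pe2 e11 e22 e12].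
have mu0 : (conformal_factor p)^-1 != 0 by rewrite invr_eq0 conformal_factor_neq0.
have compl := frame_completeness pS pe1 pe2 mu0 e11 e22 e12.
have s22 := compl 2 2; have s20 := compl 2 0; have s21 := compl 2 1.
have d0 := den_neq0 (p 0 2).
rewrite /= in s22 s20 s21.
have entry ds' ds s x a1 a2 :
    e1 0 2 * a1 + e2 0 2 * a2 = - ((conformal_factor p)^-1 * p 0 2 * x) ->
    (ds' * e1 0 2 * (e1 0 2 * x)
      + ds * (2 * e1 0 2 * a1 - (conformal_factor p)^-1 * p 0 2 * x)
      - s * ((conformal_factor p)^-1 * x))
    + (ds' * e2 0 2 * (e2 0 2 * x)
      + ds * (2 * e2 0 2 * a2 - (conformal_factor p)^-1 * p 0 2 * x)
      - s * ((conformal_factor p)^-1 * x))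
    = (conformal_factor p)^-1 *
        (ds' * (1 - p 0 2 ^+ 2) - 4 * p 0 2 * ds - 2 * s) * x.
  move=> sx; transitivity (ds' * x * (e1 0 2 * e1 0 2 + e2 0 2 * e2 0 2)
    + 2 * ds * (e1 0 2 * a1 + e2 0 2 * a2)
    - 2 * ds * (conformal_factor p)^-1 * p 0 2 * x -
      2 * s * (conformal_factor p)^-1 * x); first by ring.
  by rewrite s22 sx; ring.
rewrite /whitney_hess e11 e22; apply/rowP; apply: ord4P; rewrite !mxE/= entry;
  rewrite ?s20 ?s21; try ring.
all: rewrite /conformal_factor /prof_re /prof_im /dprof_re /dprof_im.
all: rewrite /ddprof_re /ddprof_im /JH_re /JH_im; field.
all: by rewrite r0 den_neq0.
Qed.

Lemma second_formE (p v : E3) : S2 p -> sphere_tangent p v ->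
  second_form f p v v = whitney_hess p v - tangential f p (whitney_hess p v).
Proof. by move=> pS pv; rewrite -(sphere_diff_tan_proj pS pv). Qed.

(** The trace of the flat second derivative is already normal, so removing
    tangential parts does not change it. *)
Lemma mean_curvatureE (p : E3) : S2 p -> mean_curvature f p = whitney_H p.
Proof.
move=> pS; apply: metric_traceE => // e1 e2 frame.
have [pe1 pe2 _ _ _] := frame.
rewrite (second_formE pS pe1) (second_formE pS pe2).
rewrite addrACA.
rewrite -opprD.
rewrite -(tangentialD _ _ pS).
rewrite (whitney_hess_trace pS frame).
rewrite tangential_normal ?subr0// => w pw.
rewrite dot_cvec_jet// /prof_re /prof_im /dprof_re /dprof_im /JH_re /JH_im.
by field; rewrite r0 den_neq0.
Qed.

Lemma sphere_diff_JH (p v : E3) : S2 p -> sphere_tangent p v ->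
  sphere_diff (fun q => Jc (mean_curvature f q)) p v =
  jet (dJH_re r (p 0 2)) (dJH_im r (p 0 2)) (JH_re r (p 0 2)) (JH_im r (p 0 2)) p v.
Proof.
move=> pS pv; have JHE q : S2 q ->
    Jc (mean_curvature f q) =
    cvec (JH_re r (q 0 2)) (JH_im r (q 0 2)) (q 0 0) (q 0 1).
  by move=> qS; rewrite mean_curvatureE// Jc_cvec opprK.
apply: (sphere_diff_unique pS pv JHE).
by apply: is_derive_profile => //; [exact: sderive_JH_re|exact: sderive_JH_im].
Qed.

(** For the profiles of JH and of the immersion the coefficient of v_3 w_3 in
    dot_jet vanishes identically: this is the conformality of JH. *)
Lemma nabla_JH (p v w : E3) : S2 p -> sphere_tangent p v -> sphere_tangent p w ->
  dot (nabla f (fun q => Jc (mean_curvature f q)) p v) (sphere_diff f p w) =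
  8 * p 0 2 / (r ^+ 2 * (1 + p 0 2 ^+ 2)) * metric f p v w.
Proof.
move=> pS pv pw; rewrite /nabla sphere_diff_JH// sphere_diff_whitney//.
rewrite dot_tangential// dot_jet// metricE// /conformal_factor.
rewrite /prof_re /prof_im /dprof_re /dprof_im /JH_re /JH_im /dJH_re /dJH_im.
by field; rewrite r0 den_neq0.
Qed.

Lemma divergence_JH (p : E3) : S2 p ->
  divergence f (fun q => Jc (mean_curvature f q)) p =
  2 * (8 * p 0 2 / (r ^+ 2 * (1 + p 0 2 ^+ 2))).
Proof.
move=> pS; apply: (metric_traceE pS) => e1 e2 [pe1 pe2 e11 e22 _].
have := nabla_JH pS pe1 pe1; have := nabla_JH pS pe2 pe2.
rewrite e11 e22 !mulr1; set s := 8 * _ / _ => h2 h1.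
have -> : 2 * s = s + s by ring.
exact (f_equal2 (fun x y : R => x + y) (esym h1) (esym h2)).
Qed.

Lemma whitney_conformal_maslov_form (S : set E3) :
  S `<=` S2 -> conformal_maslov_form f S.
Proof.
move=> SS2 JH p v w /SS2 pS pv pw.
by rewrite (divergence_JH pS) (nabla_JH pS pv pw); ring.
Qed.

End WhitneyGeometry.

(** * Smoothness, domains of the sphere and their boundaries *)

Section WhitneySmooth.
Context {R : realType} (V : normedModType R) (U : set V) (oU : open U).

Lemma Cn_whitney (r : R) n (g : V -> 'rV[R]_3) :
  (forall i, Cn n U (fun x => g x 0 i : R^o)) ->
  Cn n U (fun x => whitney r (g x)).
Proof.
move=> gC; have scal : Cn n U (fun x => r / (1 + g x 0 2 * g x 0 2) : R^o).
  apply: (CnM oU); first exact: Cn_cst.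
  apply: (CnV oU) => [x _|]; first by rewrite -expr2 den_neq0.
  by apply: (CnD oU); [exact: Cn_cst|apply: CnM].
apply: (Cn_row oU); apply: ord4P.
- apply: (Cn_ext oU) (CnM oU scal (gC 0)) => x _; by rewrite !mxE/= expr2.
- apply: (Cn_ext oU) (CnM oU scal (gC 1)) => x _; by rewrite !mxE/= expr2.
- apply: (Cn_ext oU) (CnM oU scal (CnM oU (gC 0) (gC 2))) => x _.
  by rewrite !mxE/= expr2.
- apply: (Cn_ext oU) (CnM oU scal (CnM oU (gC 1) (gC 2))) => x _.
  by rewrite !mxE/= expr2.
Qed.
End WhitneySmooth.

Section Domains.
Context {R : realType}.
Local Notation E3 := 'rV[R]_3.
Local Notation S2 := (@usphere R 3).

Lemma open_neq0 (V : normedModType R) : open [set x : V | x != 0].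
Proof.
rewrite (_ : [set x | _] = ~` [set 0]).
  rewrite openC; apply: accessible_closed_set1.
  exact: hausdorff_accessible (@norm_hausdorff _ V).
by apply/seteqP; split=> x /= /eqP.
Qed.

Lemma Cn_dot n m (U : set 'rV[R]_m) : open U ->
  Cn n U (fun x : 'rV[R]_m => dot x x : R^o).
Proof.
move=> oU; apply: (Cn_sum oU) => i; apply: (CnM oU); exact: Cn_coord.
Qed.

Lemma sphere_smooth_whitney (r : R) : sphere_smooth (whitney r).
Proof.
move=> n; apply: (Cn_whitney (@open_neq0 _)) => i.
have oU := @open_neq0 E3.
apply: (Cn_ext oU (f := fun x : E3 => (Num.sqrt (dot x x))^-1 * x 0 i : R^o)).
  by move=> x _; rewrite mxE.
apply: (CnM oU); last exact: Cn_coord.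
apply: (CnV oU) => [x /dot_gt0 x0|]; first by rewrite gt_eqF// sqrtr_gt0.
by apply: (Cn_sqrt oU) => [x /dot_gt0//|]; exact: Cn_dot.
Qed.

Lemma dot_continuous n : continuous (fun x : 'rV[R]_n => dot x x : R^o).
Proof.
move=> x; exact: (Cn_continuous (Cn_dot 0 (@openT 'rV[R]_n)) (x := x)).
Qed.

Lemma usphere_closed n : closed (@usphere R n).
Proof.
apply: (@preimage_closed _ _ (fun x : 'rV[R]_n => dot x x : R^o) [set 1]).
  by move=> x _; exact: dot_continuous.
exact: closed_eq.
Qed.

(** All domains below are cut out of the sphere by one inequality with a globally
    smooth function, so a single defining function serves at every boundary
    point. *)
Definition sublevel (h : E3 -> R) : set E3 := S2 `&` [set x | h x <= 0].

Lemma sublevel_closed (h : E3 -> R^o) : continuous h -> closed (sublevel h).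
Proof.
move=> hc; apply: closedI; first exact: usphere_closed.
apply: (@preimage_closed _ _ h [set y | y <= 0]) => [x _|]; first exact: hc.
exact: closed_le.
Qed.

Lemma bdry_sublevel (h : E3 -> R^o) p : continuous h ->
  bdry (sublevel h) p -> S2 p /\ h p = 0.
Proof.
move=> hc [[pS hp] clp]; split=> //; apply/eqP; rewrite eq_le hp/=.
have cl : closed [set x | 0 <= h x].
  apply: (@preimage_closed _ _ h [set y | 0 <= y]) => [x _|]; first exact: hc.
  exact: closed_ge.
have := cl; rewrite closure_id => clE.
suff : [set x | 0 <= h x] p by [].
rewrite clE; apply: closure_subset clp => x [xS xh] /=.
by rewrite leNgt; apply/negP => /ltW hx; apply: xh.
Qed.

Lemma sublevel_smooth_domain (h : E3 -> R^o) :
  Cinfty setT h ->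
  (forall p, S2 p -> h p = 0 ->
     exists2 v, sphere_tangent p v & 'D_v h p != 0) ->
  smooth_domain (sublevel h).
Proof.
move=> hC hd; have hc := Cn_setT_continuous (hC 0).
split; [exact: sublevel_closed|by move=> x []|move=> p /(bdry_sublevel hc)[pS hp]].
exists setT, h; split=> //; first exact: openT.
  by rewrite !setIT.
exact: hd.
Qed.

Lemma is_derive_entry n (g : R -> 'rV[R]_n) (t : R) v i :
  is_derive t 1 g v -> is_derive t 1 (fun s => g s 0 i : R^o) (v 0 i).
Proof.
case=> gd gv; split; first by have /derivable_mxP := gd; apply.
by rewrite -gv derive_mx// mxE.
Qed.

(** A curve in the boundary keeps both |c| = 1 and the square of the height
    constant; differentiate these two identities. *)
Lemma bdry_tangent_coords (D : set E3) (k2 : R) p v :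
  (forall q, bdry D q -> S2 q /\ q 0 2 ^+ 2 = k2) -> k2 != 0 ->
  bdry D p -> bdry_tangent D p v -> sphere_tangent p v /\ v 0 2 = 0.
Proof.
move=> Dk k0 pD [c [c0 cD cd]].
have cE i := is_derive_entry i cd.
have c2 : is_derive (0 : R) 1 (fun t => c t 0 2 * c t 0 2 : R^o)
    (p 0 2 * v 0 2 + p 0 2 * v 0 2).
  by have := is_deriveM (cE 2) (cE 2); rewrite c0.
have cc : is_derive (0 : R) 1 (fun t => dot (c t) (c t) : R^o)
    (dot p v + dot p v).
  have := is_deriveD (is_deriveD (is_deriveM (cE 0) (cE 0))
    (is_deriveM (cE 1) (cE 1))) (is_deriveM (cE 2) (cE 2)).
  rewrite c0 => cd'.
  have -> : (fun t => dot (c t) (c t) : R^o) =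
     (fun t => c t 0 0 * c t 0 0 + c t 0 1 * c t 0 1 + c t 0 2 * c t 0 2).
    by apply/funext => t; rewrite dot3.
  apply: is_derive_eq cd' _.
  by rewrite dot3 /GRing.scale/=; ring.
have near_cst (g : R -> R^o) (a d : R) : is_derive (0 : R) 1 g d ->
    (\forall t \near (0 : R), g t = a) -> d = 0.
  move=> gd ga; have [_ <-] := near_eq_is_derive ga gd.
  exact: derive_cst.
have pv : dot p v + dot p v = 0.
  by apply: (near_cst _ 1) cc _; apply: filterS cD => t /Dk[].
have v2 : p 0 2 * v 0 2 + p 0 2 * v 0 2 = 0.
  by apply: (near_cst _ k2) c2 _; apply: filterS cD => t /Dk[_]; rewrite expr2.
have p2 : p 0 2 != 0.
  by apply: contraNneq k0 => p2; have [_ <-] := Dk p pD; rewrite p2 expr0n.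
split; first by rewrite /sphere_tangent; lra.
apply: (mulfI p2); lra.
Qed.

End Domains.

(** * The polar caps and their contact angles *)

Section Caps.
Context {R : realType}.
Variables (r : R) (r_gt1 : 1 < r).
Local Notation E3 := 'rV[R]_3.
Local Notation S2 := (@usphere R 3).
Local Notation f := (whitney r).

Let r_gt0 : 0 < r. Proof. exact: lt_trans r_gt1. Qed.
Let r0 : r != 0. Proof. by rewrite gt_eqF. Qed.
Let r2p1_gt0 : 0 < r ^+ 2 + 1. Proof. by rewrite ltr_wpDl ?sqr_ge0. Qed.

(** The height of the boundary circles, found by solving
    r^2 (1 - c^2) = 1 + c^2. *)
Definition height : R := Num.sqrt ((r ^+ 2 - 1) / (r ^+ 2 + 1)).
Local Notation k := height.

Lemma height_sqr : k ^+ 2 = (r ^+ 2 - 1) / (r ^+ 2 + 1).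
Proof.
by rewrite sqr_sqrtr// divr_ge0 ?(ltW r2p1_gt0)// subr_ge0 exprn_ege1// ltW.
Qed.

Lemma height_gt0 : 0 < k.
Proof. by rewrite sqrtr_gt0 divr_gt0// subr_gt0 exprn_egt1. Qed.

Lemma height_sqr_lt1 : k ^+ 2 < 1.
Proof. by rewrite height_sqr ltr_pdivrMr// mul1r; lra. Qed.

Lemma whitney_norm2 (q : E3) : S2 q ->
  dot (f q) (f q) = r ^+ 2 * (1 - q 0 2 ^+ 2) / (1 + q 0 2 ^+ 2).
Proof.
move=> qS; rewrite whitneyE dot_cvec sphere_coordsE// /prof_re /prof_im.
by field; exact: den_neq0.
Qed.

Lemma whitney_in_ball (q : E3) : S2 q ->
  (dot (f q) (f q) <= 1) = (k ^+ 2 <= q 0 2 ^+ 2).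
Proof.
move=> qS; rewrite whitney_norm2// ler_pdivrMr ?den_gt0// height_sqr.
by rewrite ler_pdivrMr//; apply/idP/idP => ?; lra.
Qed.

Lemma whitney_on_sphere (q : E3) : S2 q -> q 0 2 ^+ 2 = k ^+ 2 ->
  dot (f q) (f q) = 1.
Proof.
move=> qS qk; rewrite whitney_norm2// qk height_sqr; field.
rewrite gt_eqF//=; have -> : r ^+ 2 + 1 + (r ^+ 2 - 1) = 2 * r ^+ 2 by ring.
by rewrite mulf_neq0 ?expf_neq0 ?pnatr_eq0.
Qed.

Definition band_fun (q : E3) : R^o := k * k + -1 * (q 0 2 * q 0 2).
Definition cap_fun (e : R) (q : E3) : R^o := k + - e * q 0 2.
(** For e = 1 and e = -1 these are the caps around the two poles. *)
Definition cap (e : R) : set E3 := sublevel (cap_fun e).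

Lemma Cinfty_band_fun : Cinfty setT band_fun.
Proof.
move=> n; rewrite /band_fun; apply: (CnD openT); first exact: (Cn_cst openT).
apply: (CnM openT); first exact: (Cn_cst openT).
by apply: (CnM openT); exact: (Cn_coord n 2 openT).
Qed.

Lemma Cinfty_cap_fun e : Cinfty setT (cap_fun e).
Proof.
move=> n; rewrite /cap_fun; apply: (CnD openT); first exact: (Cn_cst openT).
by apply: (CnM openT); [exact: (Cn_cst openT)|exact: (Cn_coord n 2 openT)].
Qed.

Lemma whitney_regionE : whitney_region r = sublevel band_fun.
Proof.
apply/seteqP; split=> q [qS].
  rewrite /= /cball/= whitney_in_ball// !expr2 => h; split=> //=.
  by rewrite /band_fun; lra.
rewrite /= /band_fun => h; split=> //=.
by rewrite /cball/= whitney_in_ball// !expr2; lra.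
Qed.

Lemma vertical_tangent (p : E3) : S2 p -> p 0 2 ^+ 2 = k ^+ 2 ->
  exists2 v, sphere_tangent p v & v 0 2 != 0.
Proof.
move=> pS pk; exists (sphere_tan_proj p (delta_mx 0 2)).
  exact: sphere_tan_projP.
rewrite /sphere_tan_proj dot3 !mxE/= gt_eqF//; have := height_sqr_lt1.
by rewrite -pk expr2; lra.
Qed.

Lemma band_smooth_domain : smooth_domain (sublevel band_fun).
Proof.
apply: sublevel_smooth_domain; first exact: Cinfty_band_fun.
move=> p pS p0; have pk : p 0 2 ^+ 2 = k ^+ 2.
  by move: p0; rewrite /band_fun !expr2; lra.
have [v pv v2] := vertical_tangent pS pk; exists v => //.
have := is_deriveD (is_derive_cst (k * k : R^o) p v)
  (is_deriveM (is_derive_cst (-1 : R^o) p v)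
    (is_deriveM (is_derive_coord 2 p v) (is_derive_coord 2 p v))).
case=> _; rewrite /GRing.scale/= => bd.
have -> : 'D_v band_fun p = -2 * p 0 2 * v 0 2.
  by rewrite -[LHS]/('D_v _ p) bd; ring.
rewrite !mulf_neq0 ?oppr_eq0 ?pnatr_eq0//.
by rewrite -sqrf_eq0 pk sqrf_eq0 gt_eqF// height_gt0.
Qed.

Section OneCap.
Variables (e : R) (e2 : e * e = 1).

Let e0 : e != 0.
Proof. by apply: contra_eq_neq e2 => ->; rewrite mul0r eq_sym oner_eq0. Qed.

Lemma cap_fun_eq0 (p : E3) : cap_fun e p = 0 -> p 0 2 = e * k.
Proof.
rewrite /cap_fun => p0; have -> : k = e * p 0 2 by lra.
by rewrite mulrA e2 mul1r.
Qed.

Lemma cap_smooth_domain : smooth_domain (cap e).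
Proof.
apply: sublevel_smooth_domain; first exact: Cinfty_cap_fun.
move=> p pS /cap_fun_eq0 pk.
have pk2 : p 0 2 ^+ 2 = k ^+ 2 by rewrite pk exprMn [e ^+ 2]expr2 e2 mul1r.
have [v pv v2] := vertical_tangent pS pk2; exists v => //.
have := is_deriveD (is_derive_cst (k : R^o) p v)
  (is_deriveM (is_derive_cst (- e : R^o) p v) (is_derive_coord 2 p v)).
case=> _; rewrite /GRing.scale/= => bd.
have -> : 'D_v (cap_fun e) p = - e * v 0 2.
  by rewrite -[LHS]/('D_v _ p) bd; ring.
by rewrite mulf_neq0 ?oppr_eq0.
Qed.

Lemma cap_region : cap e `<=` whitney_region r.
Proof.
move=> q [qS]; rewrite /cap_fun/= => qk; split=> //=.
rewrite /cball/= whitney_in_ball//.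
have -> : q 0 2 ^+ 2 = (e * q 0 2) ^+ 2 by rewrite exprMn [e ^+ 2]expr2 e2 mul1r.
by rewrite ler_pXn2r// ?nnegrE; have := height_gt0; lra.
Qed.

Lemma bdry_cap p : bdry (cap e) p -> S2 p /\ p 0 2 = e * k.
Proof.
move=> /(bdry_sublevel (Cn_setT_continuous (@Cinfty_cap_fun e 0)))[pS].
by move/cap_fun_eq0.
Qed.

End OneCap.

(** The region and its caps share everything that only depends on the boundary
    lying on the two circles of height k. *)
Section Subdomain.
Variables (D : set E3).
Hypotheses (Dreg : D `<=` whitney_region r) (Dsm : smooth_domain D)
  (Dbd : forall p, bdry D p -> S2 p /\ p 0 2 ^+ 2 = k ^+ 2).

Lemma subdomain_lagrangian : lagrangian_surface f D.
Proof.
split; first split=> //; first exact: sphere_smooth_whitney.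
- move=> p v /Dreg[pS _] pv; rewrite sphere_diff_whitney//.
  exact: dwhitney_inj.
- by move=> p v w /Dreg[pS _] pv pw; rewrite !sphere_diff_whitney// omega0_dwhitney.
Qed.

Lemma subdomain_in_ball : in_unit_ball f D.
Proof.
split=> _ [q qD <-]; first by case: (Dreg qD).
by have [qS qk] := Dbd qD; exact: whitney_on_sphere.
Qed.

Lemma subdomain_tangent p v : bdry D p -> bdry_tangent D p v ->
  sphere_tangent p v /\ v 0 2 = 0.
Proof.
apply: (bdry_tangent_coords Dbd).
by rewrite expf_neq0// gt_eqF// height_gt0.
Qed.

Lemma subdomain_legendrian : legendrian_boundary f D.
Proof.
move=> p v pD vD; have [pS _] := Dbd pD.
have [pv v2] := subdomain_tangent pD vD.
rewrite sphere_diff_whitney// whitneyE Jc_cvec /dwhitney dot_cvec_jet// v2.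
by rewrite mulr0.
Qed.

End Subdomain.

Section Contact.
Variables (e : R) (e2 : e * e = 1).

Let bdry_cap_sqr p : bdry (cap e) p -> S2 p /\ p 0 2 ^+ 2 = k ^+ 2.
Proof. by move=> /(bdry_cap e2)[pS ->]; rewrite exprMn [e ^+ 2]expr2 e2 mul1r. Qed.

(** The outward normal of the cap in the round sphere, of length
    sqrt (1 - c^2). *)
Definition cap_normal (p : E3) : E3 := - e *: sphere_tan_proj p (delta_mx 0 2).

Lemma cap_normalE (p : E3) : cap_normal p = - e *: (delta_mx 0 2 - p 0 2 *: p).
Proof.
by rewrite /cap_normal /sphere_tan_proj dot3 !mxE/= !mul0r !add0r mul1r.
Qed.

Lemma cap_normal_tangent p : S2 p -> sphere_tangent p (cap_normal p).
Proof. by move=> pS; apply/sphere_tangentZ/sphere_tan_projP. Qed.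

Lemma dot_cap_normal (p v : E3) : sphere_tangent p v ->
  dot (cap_normal p) v = - e * v 0 2.
Proof.
move=> pv; rewrite cap_normalE dotZl dotBl dotZl pv mulr0 subr0 dot3 !mxE/=.
ring.
Qed.

Lemma cap_normal2 p : S2 p -> cap_normal p 0 2 = - e * (1 - p 0 2 ^+ 2).
Proof. by move=> pS; rewrite cap_normalE !mxE/=; ring. Qed.

(** The quotient of the complex numbers i (1 + i c) / (1 - i c)^2 and
    1 / (1 - i c) is i (1 + i c)^2 / (1 + c^2); its real and imaginary parts,
    multiplied by - e, are the sine and cosine of the contact angle once p is
    on the boundary of the cap. *)
Lemma dwhitney_cap_normal (p : E3) : S2 p ->
  dwhitney r p (cap_normal p) =
  (e * (2 * p 0 2 / (1 + p 0 2 ^+ 2))) *: f p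
  + (- e * ((1 - p 0 2 ^+ 2) / (1 + p 0 2 ^+ 2))) *: Jc (f p).
Proof.
move=> pS; rewrite whitneyE Jc_cvec !cvecZ cvecD /dwhitney /jet.
rewrite cap_normal2// cap_normalE.
apply/rowP; apply: ord4P; rewrite !mxE/= /prof_re /prof_im /dprof_re /dprof_im; field;
  exact: den_neq0.
Qed.

(** The great circle through p in the normal direction is the witness.  At a
    small time t <= 0 its height times e is (k - t m) / sqrt (1 + t^2 m), with
    m = 1 - k^2, and comparing squares shows that this is at least k as
    soon as -2 k < t. *)
Lemma cap_outward p : bdry (cap e) p -> outward (cap e) p (cap_normal p).
Proof.
move=> pD; have [pS pk] := bdry_cap e2 pD; have [_ pk2] := bdry_cap_sqr pD.
have m0 : 0 < 1 - k ^+ 2 by rewrite subr_gt0 height_sqr_lt1.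
have k0 := height_gt0.
split.
  move=> /(subdomain_tangent bdry_cap_sqr pD)[_].
  rewrite cap_normal2// => /eqP; rewrite mulf_eq0 oppr_eq0 pk2.
  rewrite (gt_eqF m0) orbF => /eqP ez.
  by move: e2; rewrite ez mul0r => /eqP; rewrite eq_sym oner_eq0.
have pw := cap_normal_tangent pS.
exists (fun t => sphere_proj (t *: cap_normal p + p)); split.
- by rewrite scale0r add0r sphere_projE.
- by near=> t; apply: sphere_proj_sphere; exact: line_neq0.
- near=> t => t0; split; first by apply: sphere_proj_sphere; exact: line_neq0.
  rewrite /= /cap_fun /sphere_proj dot_line//.
  have wz := cap_normal2 pS; have ww := dot_cap_normal pw; rewrite wz in ww.
  move: (cap_normal p) pw wz ww => w pw wz ww.
  rewrite !mxE ww wz pk2 pk.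
  have -> : - e * (- e * (1 - k ^+ 2)) = 1 - k ^+ 2.
    by rewrite mulrA mulrNN e2 mul1r.
  set X := 1 + t ^+ 2 * (1 - k ^+ 2).
  have X0 : 0 < X by rewrite ltr_wpDr// mulr_ge0 ?sqr_ge0// ltW.
  have -> : k + - e * ((Num.sqrt X)^-1 * (t * (- e * (1 - k ^+ 2)) + e * k)) =
      k - (e * e) * ((k - t * (1 - k ^+ 2)) / Num.sqrt X) by ring.
  rewrite e2 mul1r subr_le0 ler_pdivlMr ?sqrtr_gt0//.
  (* makes the last factor in the factored difference of squares nonnegative *)
  have tk : - (2 * k) < t.
    have : `|t| < 2 * k.
      by near: t; apply: (@nbhs0_lt R R^o (2 * k)); rewrite mulr_gt0.
    by rewrite ltr_norml => /andP[].
  have num0 : 0 <= k - t * (1 - k ^+ 2).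
    by rewrite subr_ge0 (le_trans _ (ltW k0))// mulr_le0_ge0// ltW.
  rewrite -(ler_pXn2r (n := 2))// ?nnegrE ?mulr_ge0 ?sqrtr_ge0 ?(ltW k0)//.
  rewrite exprMn [Num.sqrt X ^+ 2]sqr_sqrtr ?(ltW X0)// /X -subr_ge0.
  have -> : (k - t * (1 - k ^+ 2)) ^+ 2 - k ^+ 2 * (1 + t ^+ 2 * (1 - k ^+ 2))
    = (- t) * (1 - k ^+ 2) * (2 * k + t + (- t) * (2 * (1 - k ^+ 2))) by ring.
  have t0' : 0 <= - t by rewrite oppr_ge0.
  have m0' := ltW m0; apply: mulr_ge0; first exact: mulr_ge0.
  by apply: addr_ge0; [lra|do 2?apply: mulr_ge0].
- have : is_derive p (cap_normal p) sphere_proj (cap_normal p).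
    by apply: is_derive_rowP => i; exact: sderive_coord.
  by move/is_derive_line.
Unshelve. all: by end_near. Qed.

Lemma cap_contact_angle p : bdry (cap e) p ->
  contact_angle f (cap e) p (acos (- e * ((1 - k ^+ 2) / (1 + k ^+ 2)))).
Proof.
move=> pD; have [pS pk] := bdry_cap e2 pD; have [_ pk2] := bdry_cap_sqr pD.
have k0 := height_gt0; have k1 := height_sqr_lt1; have d0 := den_gt0 k.
set x := - e * _.
have x2 : 1 - x ^+ 2 = (2 * k / (1 + k ^+ 2)) ^+ 2.
  rewrite /x exprMn sqrrN [e ^+ 2]expr2 e2 mul1r.
  by field; rewrite gt_eqF.
have s0 : 0 < 2 * k / (1 + k ^+ 2) by rewrite divr_gt0 ?mulr_gt0.
have /andP[x_gt x_lt] : -1 < x < 1.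
  rewrite -ltr_norml -(ltr_pXn2r (n := 2))// ?nnegrE// expr1n real_normK ?num_real//.
  by rewrite -subr_gt0 x2 exprn_gt0.
have x1 : -1 <= x <= 1 by rewrite !ltW.
split; first by rewrite acos_ge0// acos_ltpi// x_gt ltW.
have pw := cap_normal_tangent pS.
exists (cap_normal p); rewrite sin_acos// x2 sqrtr_sqr gtr0_norm// acosK ?in_itv//=.
have -> : (2 * k / (1 + k ^+ 2)) *: f p + x *: Jc (f p) =
    dwhitney r p (cap_normal p).
  rewrite dwhitney_cap_normal// pk2; congr (_ *: _ + _).
  by rewrite pk -[X in X = _]mul1r -e2; ring.
split.
- exact: cap_outward.
- by rewrite sphere_diff_whitney.
- rewrite dot_dwhitney// dot_cap_normal// cap_normal2// /conformal_factor pk2.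
  have -> : - e * (- e * (1 - k ^+ 2)) = 1 - k ^+ 2.
    by rewrite mulrA mulrNN e2 mul1r.
  rewrite height_sqr; field; rewrite gt_eqF//=.
  have -> : r ^+ 2 + 1 + (r ^+ 2 - 1) = 2 * r ^+ 2 by ring.
  by rewrite mulf_neq0 ?expf_neq0 ?pnatr_eq0.
- move=> v /(subdomain_tangent bdry_cap_sqr pD)[pv v2].
  by rewrite sphere_diff_whitney// dot_dwhitney// dot_cap_normal// v2 !mulr0.
Qed.

Lemma cap_capillary : legendrian_capillary_boundary f (cap e).
Proof.
split.
- apply: subdomain_in_ball bdry_cap_sqr; exact: cap_region.
- exact: subdomain_legendrian bdry_cap_sqr.
- by exists (acos (- e * ((1 - k ^+ 2) / (1 + k ^+ 2)))); exact: cap_contact_angle.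
Qed.

Lemma cap_lagrangian : lagrangian_surface f (cap e).
Proof.
by apply: subdomain_lagrangian; [exact: cap_region|exact: cap_smooth_domain].
Qed.

End Contact.
End Caps.

(** * Topological disks *)

Section Disks.
Context {R : realType}.

(** The ball is the union of its radii, which are segments through the origin. *)
Lemma cball_connected n : connected (@cball R n).
Proof.
have -> : @cball R n = \bigcup_(x in @cball R n) ((fun t : R => t *: x) @` `[0, 1]).
  apply/seteqP; split=> [x xB|_ [x xB [t t01 <-]]].
    by exists x => //; exists 1; rewrite ?scale1r//= in_itv/= ler01 lexx.
  move: t01; rewrite /= in_itv/= => /andP[t0 t1].
  rewrite /cball/= dotZl dotZr; apply: mulr_ile1 => //.
    by rewrite mulr_ge0 ?dot_ge0.
  by apply: mulr_ile1 => //; exact: dot_ge0.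
apply: bigcup_connected.
  exists 0 => x xB; exists 0; last by rewrite scale0r.
  by rewrite /= in_itv/= lexx ler01.
move=> x xB; apply: connected_continuous_connected.
  exact: segment_connected.
apply: continuous_subspaceT => t.
by apply: cvgZr_tmp; exact: cvg_id.
Qed.

Lemma topological_disk_connected (T : topologicalType) (A : set T) :
  @topological_disk R T A -> connected A.
Proof.
move=> [phi [psi [_ psic AB BA]]].
have -> : A = psi @` @cball R 2.
  apply/seteqP; split=> [x Ax|_ [y By <-]]; last by have [] := BA y By.
  by have [Bx xE] := AB x Ax; exists (phi x).
exact: connected_continuous_connected (@cball_connected 2) psic.
Qed.

(** A homeomorphism phi of A with the disk is transported to the image of A by f
    when it factors through f. *)
Lemma topological_disk_image (T U : topologicalType) (A : set T)
    (phi : T -> 'rV[R]_2) (psi : 'rV[R]_2 -> T) (f : T -> U) (g : U -> 'rV[R]_2) :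
  continuous psi -> continuous f -> continuous g ->
  (forall x, A x -> cball (phi x) /\ psi (phi x) = x) ->
  (forall y, cball y -> A (psi y) /\ phi (psi y) = y) ->
  (forall x, A x -> g (f x) = phi x) ->
  @topological_disk R _ (f @` A).
Proof.
move=> psic fc gc AB BA gf; exists g, (f \o psi); split.
- exact: continuous_subspaceT.
- apply: continuous_subspaceT => y; apply: continuous_comp; [exact: psic|exact: fc].
- move=> _ [x Ax <-]; rewrite gf//=; have [Bx ->] := AB x Ax; by [].
- move=> y By /=; have [Ax xE] := BA y By; rewrite gf//; split=> //.
  by exists (psi y).
Qed.

End Disks.

(** * The caps and their images as disks *)

Section CapDisks.
Context {R : realType}.
Variables (r : R) (r_gt1 : 1 < r) (e : R) (e2 : e * e = 1).
Local Notation E3 := 'rV[R]_3.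
Local Notation S2 := (@usphere R 3).
Local Notation f := (whitney r).
Local Notation k := (height r).

Let r_gt0 : 0 < r. Proof. exact: lt_trans r_gt1. Qed.
Let r0 : r != 0. Proof. by rewrite gt_eqF. Qed.

Definition radius : R := Num.sqrt (1 - k ^+ 2).

Let k1 := height_sqr_lt1 r_gt1.
Let k0 := height_gt0 r_gt1.

Lemma radius_sqr : radius ^+ 2 = 1 - k ^+ 2.
Proof. by rewrite sqr_sqrtr// subr_ge0 ltW. Qed.

Lemma radius_neq0 : radius != 0.
Proof. by rewrite gt_eqF// sqrtr_gt0 subr_gt0. Qed.

(** The horizontal projection of the cap, rescaled to the unit disk. *)
Definition flatten_cap (q : E3) : 'rV[R]_2 :=
  \row_i [:: q 0 0 / radius; q 0 1 / radius]`_i.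

Definition lift_cap (y : 'rV[R]_2) : E3 :=
  \row_i [:: radius * y 0 0; radius * y 0 1;
             e * Num.sqrt (1 - radius ^+ 2 * dot y y)]`_i.

Lemma flatten_capP q : cap r e q ->
  cball (flatten_cap q) /\ lift_cap (flatten_cap q) = q.
Proof.
move=> [qS]; rewrite /= /cap_fun => qk.
have qab := sphere_coordsE qS; have rn := radius_neq0.
have fE : dot (flatten_cap q) (flatten_cap q) = (1 - q 0 2 ^+ 2) / radius ^+ 2.
  by rewrite dot2 !mxE/= -qab; field.
have ek : k <= e * q 0 2 by lra.
split.
  rewrite /cball/= fE radius_sqr ler_pdivrMr ?subr_gt0// mul1r lerD2l lerN2.
  have -> : q 0 2 ^+ 2 = (e * q 0 2) ^+ 2 by rewrite exprMn [e ^+ 2]expr2 e2 mul1r.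
  by rewrite ler_pXn2r ?nnegrE// ?(ltW k0)// (le_trans (ltW k0)).
have E2 : e * Num.sqrt (1 - radius ^+ 2 *
    dot (flatten_cap q) (flatten_cap q)) = q 0 2.
  have -> : 1 - radius ^+ 2 * dot (flatten_cap q) (flatten_cap q) = q 0 2 ^+ 2.
    by rewrite fE; field.
  have -> : q 0 2 ^+ 2 = (e * q 0 2) ^+ 2 by rewrite exprMn [e ^+ 2]expr2 e2 mul1r.
  rewrite sqrtr_sqr ger0_norm ?(le_trans (ltW k0))//.
  by rewrite mulrA e2 mul1r.
apply/rowP; apply: ord3P; rewrite mxE /= ?E2//.
- by rewrite mxE/= mulrCA mulfV// mulr1.
- by rewrite mxE/= mulrCA mulfV// mulr1.
Qed.

Lemma lift_capP y : cball y -> cap r e (lift_cap y) /\ flatten_cap (lift_cap y) = y.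
Proof.
move=> yB; have rn := radius_neq0.
have sq : k ^+ 2 <= 1 - radius ^+ 2 * dot y y.
  rewrite radius_sqr lerBrDl -lerBrDr.
  by rewrite ler_piMr// subr_ge0 ltW.
have sq0 : 0 <= 1 - radius ^+ 2 * dot y y by rewrite (le_trans _ sq)// sqr_ge0.
split; last first.
  by apply/rowP; apply: ord2P; rewrite !mxE/= mulrC mulKf.
split; rewrite /usphere/= ?dot3 ?/cap_fun !mxE/=.
  transitivity (radius ^+ 2 * dot y y +
      (e * e) * Num.sqrt (1 - radius ^+ 2 * dot y y) ^+ 2).
    by rewrite [in X in _ = X + _]dot2; ring.
  by rewrite e2 mul1r (sqr_sqrtr sq0) addrC subrK.
rewrite mulNr mulrA e2 mul1r subr_le0.
by rewrite -[leLHS](@ger0_norm _ k) ?(ltW k0)// -sqrtr_sqr ler_wsqrtr.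
Qed.

Lemma flatten_cap_continuous : continuous flatten_cap.
Proof.
apply: (@Cn_setT_continuous R 0); apply: (Cn_row openT).
have entry i : Cn 0 setT (fun q : E3 => q 0 i * radius^-1 : R^o).
  by apply: (CnM openT); [exact: (Cn_coord _ _ openT)|exact: (Cn_cst openT)].
by apply: ord2P; apply: (Cn_ext openT) (entry _) => q _; rewrite mxE.
Qed.

Lemma lift_cap_continuous : continuous lift_cap.
Proof.
have entry i : continuous (fun y : 'rV[R]_2 => radius * y 0 i : R^o).
  apply: (@Cn_setT_continuous R 0); apply: (CnM openT).
    exact: (Cn_cst openT).
  exact: (Cn_coord _ _ openT).
have rad : continuous (fun y : 'rV[R]_2 => 1 + - radius ^+ 2 * dot y y : R^o).
  apply: (@Cn_setT_continuous R 0); apply: (CnD openT); first exact: (Cn_cst openT).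
  by apply: (CnM openT); [exact: (Cn_cst openT)|exact: (Cn_dot 0 openT)].
move=> y; apply: continuous_rowP; apply: ord3P.
- have -> : (fun x => lift_cap x 0 0 : R^o) = (fun x => radius * x 0 0).
    by apply/funext => x; rewrite mxE.
  exact: entry.
- have -> : (fun x => lift_cap x 0 1 : R^o) = (fun x => radius * x 0 1).
    by apply/funext => x; rewrite mxE.
  exact: entry.
- have -> : (fun x => lift_cap x 0 2 : R^o) =
      (fun x => e * Num.sqrt (1 + - radius ^+ 2 * dot x x)).
    by apply/funext => x; rewrite mxE /= mulNr.
  have sq := continuous_comp (rad y) (@sqrt_continuous R _).
  exact: (cvgM (cvg_cst (e : R^o)) sq).
Qed.

Lemma whitney_continuous : continuous f.
Proof.
apply: (@Cn_setT_continuous R 0); apply: (Cn_whitney openT r (g := id)) => i.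
exact: (Cn_coord _ _ openT).
Qed.

(** The projection of the cap expressed through the image z: since |z| determines
    c^2, the factor 1 + c^2 equals 2 r^2 / (r^2 + |z|^2). *)
Definition unwhitney (z : 'rV[R]_4) : 'rV[R]_2 :=
  \row_i [:: 2 * r / (r ^+ 2 + dot z z) * z 0 0 / radius;
             2 * r / (r ^+ 2 + dot z z) * z 0 1 / radius]`_i.

Lemma unwhitneyK q : S2 q -> unwhitney (f q) = flatten_cap q.
Proof.
move=> qS; have dn := den_neq0 (q 0 2); have rn := radius_neq0.
have nE : r ^+ 2 + dot (f q) (f q) = 2 * r ^+ 2 / (1 + q 0 2 ^+ 2).
  by rewrite whitney_norm2//; field.
apply/rowP; apply: ord2P; rewrite [LHS]mxE [RHS]mxE /= nE whitneyE mxE/= /prof_re;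
by field; rewrite rn r0 dn.
Qed.

Lemma unwhitney_continuous : continuous unwhitney.
Proof.
apply: (@Cn_setT_continuous R 0); apply: (Cn_row openT).
have entry i : Cn 0 setT (fun z : 'rV[R]_4 =>
    2 * r * (r ^+ 2 + dot z z)^-1 * z 0 i * radius^-1 : R^o).
  apply: (CnM openT); last exact: (Cn_cst openT).
  apply: (CnM openT); last exact: (Cn_coord _ _ openT).
  apply: (CnM openT); first exact: (Cn_cst openT).
  apply: (CnV openT) => [z _|].
    by rewrite gt_eqF// ltr_pwDl ?exprn_gt0 ?dot_ge0.
  by apply: (CnD openT); [exact: (Cn_cst openT)|exact: (Cn_dot 0 openT)].
by apply: ord2P; apply: (Cn_ext openT) (entry _) => z _; rewrite mxE.
Qed.

Lemma cap_disk : @topological_disk R _ (cap r e).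
Proof.
exists flatten_cap, lift_cap; split.
- exact/continuous_subspaceT/flatten_cap_continuous.
- exact/continuous_subspaceT/lift_cap_continuous.
- exact: flatten_capP.
- exact: lift_capP.
Qed.

Lemma cap_image_disk : @topological_disk R _ (f @` cap r e).
Proof.
apply: (topological_disk_image lift_cap_continuous whitney_continuous
  unwhitney_continuous flatten_capP lift_capP) => q [qS _].
exact: unwhitneyK.
Qed.

Lemma cap_closed : closed (cap r e).
Proof. exact: sublevel_closed (Cn_setT_continuous (@Cinfty_cap_fun _ r e 0)). Qed.

Lemma cap_pole : cap r e (\row_i [:: 0; 0; e]`_i).
Proof.
split; first by rewrite /usphere/= dot3 !mxE/= e2; ring.
rewrite /= /cap_fun !mxE/= mulNr e2 subr_le0.
rewrite -(ler_pXn2r (n := 2)) ?nnegrE ?(ltW k0)// expr1n; exact: ltW.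
Qed.

End CapDisks.

(** * Connected components *)

Section Components.
Context {R : realType}.
Variables (r : R) (r_gt1 : 1 < r).

Let k0 := height_gt0 r_gt1.

Lemma region_caps : whitney_region r = cap r 1 `|` cap r (-1).
Proof.
apply/seteqP; split=> [q qr|q []]; last 2 first.
- by apply: (cap_region r_gt1); rewrite mulr1.
- by apply: (cap_region r_gt1); rewrite mulrNN mulr1.
move: qr; rewrite whitney_regionE// => -[qS]; rewrite /= /band_fun => qk.
have [q2|q2] := leP 0 (q 0 2); [left|right]; split=> //=; rewrite /cap_fun.
  have : height r ^+ 2 <= q 0 2 ^+ 2 by rewrite !expr2; lra.
  by rewrite ler_pXn2r ?nnegrE ?(ltW k0)// => h /=; lra.
have : height r ^+ 2 <= (- q 0 2) ^+ 2 by rewrite !expr2; lra.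
by rewrite ler_pXn2r ?nnegrE ?(ltW k0) ?oppr_ge0 ?(ltW q2)// => h /=; lra.
Qed.

Lemma caps_disjoint q : cap r 1 q -> ~ cap r (-1) q.
Proof. by move=> [_ +] [_]; have := k0; rewrite /= /cap_fun; lra. Qed.

Lemma separated_caps : separated (cap r 1) (cap r (-1)).
Proof.
split; rewrite -(closure_id _).1; try exact: cap_closed.
all: by rewrite -subset0 => q [q1 q2]; exact: (caps_disjoint q1 q2).
Qed.

(** A connected subset of the union of the two separated caps lies in one of
    them. *)
Lemma component_cap (e : R) q : (e == 1) || (e == -1) -> cap r e q ->
  connected_component (whitney_region r) q = cap r e.
Proof.
move=> e1 qe; have e2 : e * e = 1.
  by case/orP: e1 => /eqP ->; rewrite ?mulrNN mulr1.
apply/seteqP; split; last first.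
  apply: connected_component_max => //; first exact: cap_region.
  exact/topological_disk_connected/cap_disk.
have := connected_subset separated_caps _
  (@component_connected _ (whitney_region r) q).
rewrite -region_caps => /(_ (@connected_component_sub _ _ _)) sub.
have qq : connected_component (whitney_region r) q q.
  by apply: connected_component_refl; exact: (cap_region r_gt1 e2).
case/orP: e1 => /eqP ee; rewrite ee in qe *; case: sub => // /(_ _ qq) qe'.
  by case: (caps_disjoint qe qe').
by case: (caps_disjoint qe' qe).
Qed.

End Components.

Theorem proposition2p7 (R : realType) (r : R) (hr : 1 < r) :
  let f := whitney r in
  let S := whitney_region r in
  [/\ lagrangian_surface f S,
      in_unit_ball f S,
      legendrian_boundary f S,
      conformal_maslov_form f S
    & exists D1 D2 : set 'rV[R]_3,
      [/\ D1 <> D2,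
          [set D | component S D] = [set D1; D2],
          f @` @usphere R 3 `&` @cball R 4 = f @` D1 `|` f @` D2
        & forall D, component S D ->
          [/\ lagrangian_surface f D,
              legendrian_capillary_boundary f D,
              @topological_disk R _ D
            & @topological_disk R _ (f @` D)]]].
Proof.
move=> f S.
have r_gt0 : 0 < r by exact: lt_trans hr.
have reg : S `<=` S by [].
have dom : smooth_domain S.
  by rewrite /S whitney_regionE//; exact: band_smooth_domain.
have bd p : bdry S p -> usphere p /\ p 0 2 ^+ 2 = height r ^+ 2.
  rewrite /S whitney_regionE//.
  move=> /(bdry_sublevel (Cn_setT_continuous (@Cinfty_band_fun _ r 0)))[pS].
  by rewrite /band_fun !expr2; split=> //; lra.
have p1 : (1 : R) * 1 = 1 by rewrite mulr1.
have n1 : (-1 : R) * -1 = 1 by rewrite mulrNN mulr1.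
split.
- exact: subdomain_lagrangian.
- exact: subdomain_in_ball.
- exact: (subdomain_legendrian hr bd).
- by apply: (whitney_conformal_maslov_form r_gt0) => q [].
have comp D : component S D ->
    exists2 e, e * e = 1 & D = cap r e /\ (e == 1) || (e == -1).
  move=> [q]; rewrite /S region_caps// => -[] qe ->; rewrite -region_caps//.
    by exists 1 => //; split; rewrite ?eqxx// (component_cap hr _ qe) ?eqxx.
  by exists (-1) => //; split; rewrite ?eqxx ?orbT// (component_cap hr _ qe) ?eqxx ?orbT.
exists (cap r 1), (cap r (-1)); split.
- move=> capE; have q1 := cap_pole hr p1; apply: (caps_disjoint hr q1).
  by rewrite -capE.
- apply/seteqP; split=> [D /comp[e _ [-> /orP[]/eqP->]]|D []->]; [by left|by right|..].
    exists (\row_i [:: 0; 0; 1]`_i); first exact: (cap_region hr p1 (cap_pole hr p1)).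
    by rewrite (component_cap hr _ (cap_pole hr p1)) ?eqxx.
  exists (\row_i [:: 0; 0; -1]`_i); first exact: (cap_region hr n1 (cap_pole hr n1)).
  by rewrite (component_cap hr _ (cap_pole hr n1)) ?eqxx ?orbT.
- rewrite -image_setU -region_caps//; apply/seteqP; split.
    by move=> _ [[q qS <-] qB]; exists q.
  by move=> _ [q [qS qB] <-]; split=> //; exists q.
- move=> D /comp[e e2 [-> _]]; split.
  + exact: cap_lagrangian.
  + exact: cap_capillary.
  + exact: cap_disk.
  + exact: cap_image_disk.
Qed.
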